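(* Let $\mathcal{O}\subset\mathbb{R}$ be a connected open set and let $f:\mathcal{O}\to\mathbb{R}$ be a real analytic function with $f^{(2)}>0$ and $f^{(3)}>0$ on $\mathcal{O}$. Let $\mathcal{M}_{f,\mathcal{O}}$ be the manifold $\{(x,y,\tilde x,\tilde y)\in\mathbb{R}^4:y\in\mathcal{O}\}$ with the metric $g_f$ whose non-zero components (up to symmetry) are $g_f(\partial_x,\partial_x)=-2f(y)$ and $g_f(\partial_x,\partial_{\tilde x})=g_f(\partial_y,\partial_{\tilde y})=1$. Then the following assertions are equivalent: (1) $\mathcal{M}_{f,\mathcal{O}}$ is locally homogeneous. (2) $\mathcal{M}_{f,\mathcal{O}}$ is $2$-curvature homogeneous. (3) The function $\alpha_2:=f^{(4)}f^{(2)}\{f^{(3)}\}^{-2}$ is constant on $\mathcal{O}$. (4) Either $f^{(2)}=a(y+b)^c$ or $f^{(2)}=ae^{\lambda y}$ (on $\mathcal{O}$, for some real constants $a,b,c$, respectively $a,\lambda$).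
   Context: $f^{(j)}$ denotes the $j$-th derivative of $f$. A pseudo-Riemannian manifold is locally homogeneous if for any two points $P,Q$ there is an isometry from a neighborhood of $P$ onto a neighborhood of $Q$ taking $P$ to $Q$. A pseudo-Riemannian manifold $\mathcal{M}=(M,g)$ is $k$-curvature homogeneous if there is a tuple $(V,\langle\cdot,\cdot\rangle,A^0,\dots,A^k)$, with $V$ a finite dimensional real vector space, $\langle\cdot,\cdot\rangle$ a non-degenerate inner product on $V$ and $A^i\in\otimes^{4+i}V^*$, such that for every $P\in M$ there is a linear isomorphism $\Phi_P:T_PM\to V$ with $\Phi_P^*\langle\cdot,\cdot\rangle=g|_{T_PM}$ and $\Phi_P^*A^i=\nabla^iR|_{T_PM}$ for $0\le i\le k$, where $\nabla^iR$ is the $i$-th covariant derivative of the curvature tensor.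
   Formalization: In (4), a(y+b)^c is read as a|y+b|^c, since with real constants the literal power is undefined for y+b<0 and non-integral c: f''=(-y)^(-1/2) on y<0 has f'',f'''>0 and constant alpha_2=3 but is not of the literal form. *)

(* Defs.v *)
From HB Require Import structures.
From mathcomp Require Import all_boot all_order all_algebra.
From mathcomp Require Import all_classical all_reals all_analysis.
Set Implicit Arguments.
Unset Strict Implicit.
Unset Printing Implicit Defensive.
Import Order.TTheory GRing.Theory Num.Theory numFieldNormedType.Exports.
Local Open Scope ring_scope.
Local Open Scope classical_set_scope.

Definition real_analytic (R : realType) (O : set R) (f : R -> R) : Prop :=
  forall a, O a -> exists c : nat -> R,
    \forall y \near a, series (fun k => c k * (y - a) ^+ k) @ \oo --> f y.

(** [k]-fold differentiability on an open set: [F] is Fréchet differentiable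
    and each directional derivative [x |-> 'd F x v] is [k - 1] times
    differentiable.  In finite dimension, having this for all [k] is the usual
    C^oo condition. *)
Fixpoint ndifferentiable (R : realType) (V W : normedModType R) (k : nat)
    (U : set V) (F : V -> W) : Prop :=
  if k is k'.+1 then
    (forall x, U x -> differentiable F x) /\
    (forall v, ndifferentiable k' U ('D_v F))
  else True.

Definition smooth (R : realType) (V W : normedModType R)
    (U : set V) (F : V -> W) : Prop :=
  forall k, ndifferentiable k U F.

(** ** Pseudo-Riemannian geometry in a single chart

    The manifold is an open set [U] of R^n (row vectors), every tangent space
    is identified with R^n by the coordinate frame, and a metric is given by
    its Gram matrix field [g] in that frame. A tangent vector [u : 'rV_n] also
    stands for the vector field with constant coefficients [u]. *)

Definition inner (R : realType) n (g : 'rV[R]_n -> 'M[R]_n)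
    (x u v : 'rV[R]_n) : R := (u *m g x *m v^T) 0 0.

(** Koszul formula for [g(nabla_u v, z)], where [u], [v], [z] are constant (so
    that all Lie brackets vanish). *)
Definition christoffel1 (R : realType) n (g : 'rV[R]_n -> 'M[R]_n)
    (x u v z : 'rV[R]_n) : R :=
  2^-1 * ('D_u (fun p => inner g p v z) x + 'D_v (fun p => inner g p u z) x
          - 'D_z (fun p => inner g p u v) x).

(** [nabla_u v] for constant [u], [v]: the vector [w] such that
    [inner g x w z = christoffel1 g x u v z] for all [z]. *)
Definition christoffel (R : realType) n (g : 'rV[R]_n -> 'M[R]_n)
    (x u v : 'rV[R]_n) : 'rV[R]_n :=
  (\row_k christoffel1 g x u v (delta_mx 0 k)) *m invmx (g x).

(** Levi-Civita derivative of an arbitrary vector field [Y]. *)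
Definition nabla (R : realType) n (g : 'rV[R]_n -> 'M[R]_n)
    (u : 'rV[R]_n) (Y : 'rV[R]_n -> 'rV[R]_n) (x : 'rV[R]_n) : 'rV[R]_n :=
  'D_u Y x + christoffel g x u (Y x).

(** The bracket term of the curvature operator vanishes on constant fields. *)
Definition curvature_op (R : realType) n (g : 'rV[R]_n -> 'M[R]_n)
    (u v w x : 'rV[R]_n) : 'rV[R]_n :=
  nabla g u (nabla g v (fun=> w)) x - nabla g v (nabla g u (fun=> w)) x.

(** A covariant tensor field of order [m], as the value at a point on [m]
    tangent vectors. *)
Definition tensor_field (R : realType) n m :=
  'rV[R]_n -> ('I_m -> 'rV[R]_n) -> R.

Definition curvature_tensor (R : realType) n (g : 'rV[R]_n -> 'M[R]_n) :
    tensor_field R n 4 :=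
  fun x v =>
    inner g x (curvature_op g (v (inord 0)) (v (inord 1)) (v (inord 2)) x)
              (v (inord 3)).

Definition update (T : Type) m (v : 'I_m -> T) (i : 'I_m) (u : T) : 'I_m -> T :=
  fun j => if j == i then u else v j.

(** [(nabla T)(v_0, .., v_(m-1); w)]: the direction of differentiation is the
    last slot. *)
Definition nabla_tensor (R : realType) n m (g : 'rV[R]_n -> 'M[R]_n)
    (T : tensor_field R n m) : tensor_field R n m.+1 :=
  fun x vw =>
    let w := vw ord_max in
    let v := fun i : 'I_m => vw (widen_ord (leqnSn m) i) in
    'D_w (fun p => T p v) x
    - \sum_(i < m) T x (update v i (christoffel g x w (v i))).

Fixpoint nabla_curvature (R : realType) n (g : 'rV[R]_n -> 'M[R]_n) (i : nat) :
    tensor_field R n (4 + i) :=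
  if i is j.+1 then nabla_tensor g (@nabla_curvature R n g j)
  else curvature_tensor g.
Arguments nabla_curvature {R n} g i x v.

(** [phi] restricts to an isometry from [A] onto [B]; [psi] is its inverse. *)
Definition isometry_onto (R : realType) n (g : 'rV[R]_n -> 'M[R]_n)
    (A B : set 'rV[R]_n) (phi : 'rV[R]_n -> 'rV[R]_n) : Prop :=
  [/\ phi @` A = B, smooth A phi,
      (exists psi : 'rV[R]_n -> 'rV[R]_n,
         (forall x, A x -> psi (phi x) = x) /\ smooth B psi)
    & forall x, A x -> forall u v,
        inner g (phi x) ('d phi x u) ('d phi x v) = inner g x u v].

Definition locally_homogeneous (R : realType) n (U : set 'rV[R]_n)
    (g : 'rV[R]_n -> 'M[R]_n) : Prop :=
  forall P Q, U P -> U Q ->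
    exists (A B : set 'rV[R]_n) (phi : 'rV[R]_n -> 'rV[R]_n),
      [/\ open_nbhs P A /\ A `<=` U, open_nbhs Q B /\ B `<=` U,
          isometry_onto g A B phi & phi P = Q].

Definition multilinear (R : realType) (V : lmodType R) m
    (A : ('I_m -> V) -> R) : Prop :=
  forall (i : 'I_m) (v : 'I_m -> V), scalar (fun u => A (update v i u)).

Definition curvature_homogeneous (R : realType) n (k : nat) (U : set 'rV[R]_n)
    (g : 'rV[R]_n -> 'M[R]_n) : Prop :=
  exists (V : vectType R) (ip : {biscalar V})
         (A : forall i : 'I_k.+1, ('I_(4 + i) -> V) -> R),
    [/\ (forall u v, ip u v = ip v u),
        (forall u, (forall v, ip u v = 0) -> u = 0),
        (forall i, multilinear (A i))
      & forall P, U P ->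
          exists Phi : {linear 'rV[R]_n -> V},
            [/\ bijective Phi,
                (forall u v, ip (Phi u) (Phi v) = inner g P u v)
              & forall (i : 'I_k.+1) (v : 'I_(4 + i) -> 'rV[R]_n),
                  A i (fun j => Phi (v j)) = nabla_curvature g i P v]].

(** ** The manifold M_{f,O}

    The coordinates 0, 1, 2, 3 are x, y, x~, y~. *)

Definition coord_y (R : realType) (p : 'rV[R]_4) : R := p 0 (inord 1).

Definition Mf_domain (R : realType) (O : set R) : set 'rV[R]_4 :=
  [set p | O (coord_y p)].

Definition gf (R : realType) (f : R -> R) (p : 'rV[R]_4) : 'M[R]_4 :=
  \matrix_(i < 4, j < 4)
    match nat_of_ord i, nat_of_ord j with
    | 0%N, 0%N => - 2 * f (coord_y p)
    | 0%N, 2%N | 2%N, 0%N | 1%N, 3%N | 3%N, 1%N => 1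
    | _, _ => 0
    end.

Definition alpha2 (R : realType) (f : R -> R) (y : R) : R :=
  f^`(4)%classic y * f^`(2)%classic y * (f^`(3)%classic y) ^- 2.

(** Since [c] is an arbitrary real exponent and [y + b] may be negative on all
    of [O], the power [(y + b)^c] is read as [|y + b|^c]. For integral [c] this
    agrees with the literal power up to the sign of [a]; for other [c] it is
    needed, as [f'' = (- y)^(-1/2)] on [y < 0] has constant [alpha2]. A zero of
    [y + b] in [O] is incompatible with [f'' > 0] and [f''' > 0]. *)
Definition power_form (R : realType) (O : set R) (h : R -> R) : Prop :=
  exists a b c : R, forall y, O y -> h y = a * `|y + b| `^ c.

Definition exponential_form (R : realType) (O : set R) (h : R -> R) : Prop :=
  exists a lambda : R, forall y, O y -> h y = a * expR (lambda * y).

(* Main.v *)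
Require Import Defs.
From HB Require Import structures.
From mathcomp Require Import all_boot all_order all_algebra.
From mathcomp Require Import all_classical all_reals all_analysis.
From mathcomp Require Import ring lra.
Import Order.TTheory GRing.Theory Num.Theory numFieldNormedType.Exports.
Local Open Scope ring_scope.
Local Open Scope classical_set_scope.
Set Implicit Arguments.
Unset Strict Implicit.
Unset Printing Implicit Defensive.

(** Let [w = dx /\ dy].  The coordinate fields satisfy
    [nabla_x d_x = f' d_y~] and [nabla_x d_y = nabla_y d_x = - f' d_x~], all other
    covariant derivatives being zero; hence
    [nabla^i R = - f^(2+i) w (x) w (x) dy^i].

    (2) => (3): a linear map matching these tensors at two points multiplies
    [w] by some [t] and [dy] by some [s] on a test plane, so [f'', f''', f'''']
    change by the factors [t^2, t^2 s, t^2 s^2], and [alpha_2] is unchanged.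

    (3) => (4): [(f'' / f''')' = 1 - alpha_2], so [f'' / f'''] is affine.

    (4) => (1): [f''(s y + b)] is a constant multiple of [f''(y)] for enough
    pairs [(s, b)], so [r^2 f(s y + b) - f(y)] is affine for a suitable [r], and
    this affine defect is absorbed by quadratic terms in the coordinates
    [x~, y~].

    (1) => (2): let [phi] be a local isometry with components
    [phi_0, .., phi_3].  Comparing Levi-Civita connections expresses the second
    derivatives of [phi_0], [phi_1], [phi_3] through the first ones.  Symmetry
    of third derivatives then shows that [phi_0] and [phi_1] are killed by
    [d_x~], [d_y~] and have zero second derivatives, so that
    [phi^* w = t w] with [t] constant; applied to [phi_3] it gives
    [f'' = t^2 f'' o phi_1].  Differentiating twice in [x] and [y] gives
    [phi^* dy = s dy] and the relations for [f'''] and [f''''], hence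
    the differential of [phi] preserves [R], [nabla R] and [nabla^2 R]. *)

(** * Real analytic functions *)

(** Each of the [n + 1] terms of the geometric sum up to [r ^+ n] is at least [r ^+ n], and that sum
    times [1 - r] is [1 - r ^+ n.+1]. *)
Lemma natr_exp_le (R : realType) (r : R) (n : nat) :
  0 <= r -> r < 1 -> n.+1%:R * r ^+ n * (1 - r) <= 1.
Proof.
move=> r0 r1.
have sumE : 1 - r ^+ n.+1 = (\sum_(i < n.+1) r ^+ i) * (1 - r).
  by rewrite -opprB subrX1 -mulNr opprB mulrC.
apply: (@le_trans _ _ (1 - r ^+ n.+1)); last by rewrite gerBl exprn_ge0.
rewrite sumE; apply: ler_wpM2r; first by rewrite subr_ge0 ltW.
have -> : n.+1%:R * r ^+ n = \sum_(i < n.+1) r ^+ n.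
  by rewrite sumr_const card_ord mulr_natl.
apply: ler_sum => i _.
by rewrite ler_wiXn2l// ?ltW// -ltnS.
Qed.

(** Comparison at an intermediate radius [w]: there the series of [|c n| w^n] converges, and the
    extra factor [(n + 1) (|z| / w)^n] of the differentiated series is bounded by [natr_exp_le]. *)
Lemma is_cvg_pseries_diffs (R : realType) (c : R^nat) (x z : R) :
  cvgn (pseries c x) -> `|z| < `|x| -> cvgn (pseries (pseries_diffs c) z).
Proof.
move=> cx zx.
have [w /andP[zw wx]] : exists w : R, (`|z| < w) && (w < `|x|).
  by exists ((`|z| + `|x|) / 2); rewrite !midf_lt.
have w0 : 0 < w by rewrite (le_lt_trans _ zw).
have cw : cvgn (pseries (fun i => `|c i|) w).
  by apply: (is_cvg_pseries_inside_norm cx); rewrite (gtr0_norm w0).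
pose r := `|z| / w.
have r0 : 0 <= r by rewrite divr_ge0// ltW.
have r1 : r < 1 by rewrite ltr_pdivrMr// mul1r.
apply: normed_cvg.
(* The factor [(1 - r)^-1] is the bound from [natr_exp_le]; dividing by [w] makes up for the index
   shift from [w ^+ n] to [w ^+ n.+1]. *)
pose C := (1 - r)^-1 / w.
apply: (@series_le_cvg _ _ (fun n => C * (`|c n.+1| * w ^+ n.+1))).
- by move=> n /=.
- by move=> n; rewrite !mulr_ge0 ?exprn_ge0 ?invr_ge0 ?subr_ge0// ltW.
- move=> n /=; rewrite /pseries_diffs !normrM normrX ger0_norm// /C.
  have -> : `|z| = r * w by rewrite divfK// gt_eqF.
  rewrite exprMn exprSr.
  have -> : (1 - r)^-1 / w * (`|c n.+1| * (w ^+ n * w)) =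
            (1 - r)^-1 * (`|c n.+1| * w ^+ n).
    by field; rewrite ?subr_eq0 ?gt_eqF.
  have -> : n.+1%:R * `|c n.+1| * (r ^+ n * w ^+ n) =
            (n.+1%:R * r ^+ n) * (`|c n.+1| * w ^+ n) by ring.
  apply: ler_wpM2r; first by rewrite mulr_ge0// exprn_ge0// ltW.
  by rewrite -div1r ler_pdivlMr ?subr_gt0// natr_exp_le.
- apply: is_cvg_seriesZ.
  rewrite (_ : series _ = [sequence pseries (fun i => `|c i|) w n.+1]_n
                          - cst (`|c 0%N| * w ^+ 0)).
    by apply: is_cvgB; [apply/cvg_ex; exists (limn (pseries (fun i => `|c i|) w));
      rewrite cvg_shiftS | exact: is_cvg_cst].
  apply/funext => n; rewrite /pseries /series/= !fctE.
  by rewrite big_nat_recl// addrC addKr.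
Qed.

(* Within the ball where the expansion at [a] is valid, [f] is the sum of a
   power series, which can be differentiated termwise. *)
Lemma real_analytic_derivative (R : realType) (O : set R) (f : R -> R) :
  real_analytic O f ->
  real_analytic O f^`()%classic /\ (forall a, O a -> derivable f a 1).
Proof.
move=> fO.
have key a : O a -> exists c : R^nat, \forall y \near (a : R),
    is_derive (y : R) 1 f (limn (pseries (pseries_diffs c) (y - a))) /\
    cvgn (pseries (pseries_diffs c) (y - a)).
  move=> /fO[c] /nbhs_ballP[e /= e0 fc]; exists c.
  have cvgc z : `|z| < e -> cvgn (pseries c z) /\ f (z + a) = limn (pseries c z).
    move=> ze; have := fc (z + a); rewrite /ball/= opprD addrCA subrr addr0 normrN.
    rewrite addrK => /(_ ze) h; split; first by apply/cvg_ex; exists (f (z + a)).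
    exact/esym/cvg_lim.
  have cvgd z : `|z| < e -> cvgn (pseries (pseries_diffs c) z) /\
      cvgn (pseries (pseries_diffs (pseries_diffs c)) z).
    (* Each termwise differentiation costs a strict decrease of the radius; [|z| < w < x < e] leaves
       room for two of them. *)
    move=> ze; pose x := (`|z| + e) / 2; pose w := (`|z| + x) / 2.
    have zx : `|z| < x by rewrite midf_lt.
    have xe : x < e by rewrite midf_lt.
    have zw : `|z| < w by rewrite midf_lt.
    have wx : w < x by rewrite midf_lt.
    have w0 : 0 < w by apply: le_lt_trans zw.
    have x0 : 0 < x by apply: le_lt_trans zx.
    have [cx _] : cvgn (pseries c x) /\ f (x + a) = limn (pseries c x).
      by apply: cvgc; rewrite gtr0_norm.
    split.
      by apply: (is_cvg_pseries_diffs cx); rewrite (gtr0_norm x0).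
    apply: (@is_cvg_pseries_diffs _ _ w); last by rewrite (gtr0_norm w0).
    by apply: (is_cvg_pseries_diffs cx); rewrite !gtr0_norm.
  exists e => //= y; rewrite /ball/= distrC => ye; split; last by case: (cvgd _ ye).
  have [K /andP[yK Ke]] : exists K : R, (`|y - a| < K) && (K < e).
    by exists ((`|y - a| + e) / 2); rewrite !midf_lt.
  have K0 : 0 < K by apply: le_lt_trans yK.
  have [KE1 KE2] : cvgn (pseries (pseries_diffs c) K) /\
      cvgn (pseries (pseries_diffs (pseries_diffs c)) K).
    by apply: cvgd; rewrite gtr0_norm.
  have [cK _] : cvgn (pseries c K) /\ f (K + a) = limn (pseries c K).
    by apply: cvgc; rewrite gtr0_norm.
  have yK' : `|y - a| < `|K| by rewrite (gtr0_norm K0).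
  have D := pseries_snd_diffs cK KE1 KE2 yK'.
  have D2 : is_derive y 1 (fun x => limn (pseries c (x - a)))
      (limn (pseries (pseries_diffs c) (y - a))).
    rewrite -[limn _]mulr1.
    apply: (@is_derive1_comp _ (fun x => limn (pseries c x)) (shift (- a))).
    exact: is_derive_shift.
  apply: near_eq_is_derive D2.
  exists (e - `|y - a|); first by rewrite /= subr_gt0.
  move=> z; rewrite /ball/= => yz.
  have ze : `|z - a| < e.
    have := ler_normD (z - y) (y - a); rewrite addrA subrK (distrC z y); lra.
  by have [_] := cvgc _ ze; rewrite subrK => ->.
split=> a Oa; last first.
  have [c cP] := key a Oa.
  by have [[dfa _] _] := nbhs_singleton cP; exact: dfa.
have [c cP] := key a Oa.
exists (pseries_diffs c); near=> y.
have [dy cy] : is_derive (y : R) 1 f (limn (pseries (pseries_diffs c) (y - a))) /\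
  cvgn (pseries (pseries_diffs c) (y - a)) by near: y.
by rewrite derive1E derive_val.
Unshelve. all: by end_near. Qed.

Lemma real_analytic_derive1n (R : realType) (O : set R) (f : R -> R) n :
  real_analytic O f -> real_analytic O f^`(n)%classic.
Proof.
by move=> fO; elim: n => [//|n /real_analytic_derivative[]]; rewrite derive1nS.
Qed.

Lemma derivable_derive1n (R : realType) (O : set R) (f : R -> R) n a :
  real_analytic O f -> O a ->
  is_derive a 1 f^`(n)%classic (f^`(n.+1)%classic a).
Proof.
move=> fO Oa; rewrite derive1nS derive1E; apply: derivableP.
exact: (real_analytic_derivative (real_analytic_derive1n n fO)).2.
Qed.

(** * The metric and its curvature *)

(** Reduces a directional derivative to one real variable, where the chain rule behind
    [is_derive_chain] applies. *)
Lemma is_derive_lineP (R : numFieldType) (V W : normedModType R) (F : V -> W)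
    (x v : V) (d : W) :
  is_derive x v F d <-> is_derive (0 : R) 1 (fun h => F (h *: v + x)) d.
Proof.
have E : 'D_v F x = 'D_1 (fun h : R => F (h *: v + x)) 0.
  rewrite /derive; set g1 := (X in lim (X @ _)); set g2 := (X in _ = lim (X @ _)).
  suff -> : g1 = g2 by [].
  by apply/funext => h; rewrite /g1 /g2/= addr0 scale0r add0r [_%:A]mulr1.
split=> -[dF <-]; split; rewrite ?E//.
  exact: (derivable1P F x v).1.
exact: (derivable1P F x v).2.
Qed.

(** Serves to apply the mean value theorem along segments in [second_difference]. *)
Lemma is_derive_line (R : numFieldType) (V W : normedModType R) (F : V -> W)
    (x v : V) (s : R) :
  derivable F (x + s *: v) v ->
  is_derive s 1 (fun t : R => F (x + t *: v)) ('D_v F (x + s *: v)).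
Proof.
have E : (fun h : R => h^-1 *: (F (x + (h *: 1 + s) *: v) - F (x + s *: v))) =
         (fun h : R => h^-1 *: (F (h *: v + (x + s *: v)) - F (x + s *: v))).
  by apply/funext => h; rewrite [h *: 1]mulr1 scalerDl addrCA.
by move=> dF; split; rewrite /derivable/derive/= ?E.
Qed.

Lemma is_derive_chain (R : realType) (V : normedModType R) (F : V -> R)
    (g : R -> R) (x v : V) (a b : R) :
  is_derive (F x) 1 g a -> is_derive x v F b ->
  is_derive x v (fun p => g (F p)) (a * b).
Proof.
move=> dg /is_derive_lineP dF; apply/is_derive_lineP.
by apply: (@is_derive1_comp _ g (fun h : R => F (h *: v + x)));
  rewrite ?scale0r ?add0r.
Qed.

Lemma is_derive_mx_entry (R : realType) (V : normedModType R) m n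
    (M : V -> 'M[R]_(m, n)) (x v : V) (i : 'I_m) (j : 'I_n) :
  derivable M x v -> is_derive x v (fun p => M p i j) ('D_v M x i j).
Proof.
move=> dM; rewrite derive_mx// mxE.
by apply: derivableP; move/derivable_mxP : dM.
Qed.

Lemma is_derive_entry (R : realType) n (x v : 'rV[R]_n) (i : 'I_1) (j : 'I_n) :
  is_derive x v (fun p : 'rV[R]_n => p i j) (v i j).
Proof. by have := is_derive_mx_entry i j (@derivable_id _ _ x v); rewrite derive_id. Qed.

Lemma is_derive_scalel (R : realType) (V W : normedModType R) (g : V -> R)
    (w : W) (x v : V) (d : R) :
  is_derive x v g d -> is_derive x v (fun p => g p *: w) (d *: w).
Proof.
move=> [dg <-].
have E : (fun h : R => h^-1 *: (g (h *: v + x) *: w - g x *: w)) =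
         (fun h : R => (h^-1 *: (g (h *: v + x) - g x)) *: w).
  by apply/funext => h; rewrite -scalerBl scalerA.
have C : (fun h : R => h^-1 *: (g (h *: v + x) *: w - g x *: w)) @ 0^' -->
         'D_v g x *: w.
  by rewrite E; apply: cvgZr_tmp.
by apply: DeriveDef; [apply/cvg_ex; exists ('D_v g x *: w) | exact: cvg_lim].
Qed.

Lemma sum_I4 (V : nmodType) (F : 'I_4 -> V) :
  \sum_(i < 4) F i = F (inord 0) + F (inord 1) + F (inord 2) + F (inord 3).
Proof.
rewrite !big_ord_recr big_ord0/= add0r.
by do !congr (_ + _); congr F; apply/val_inj; rewrite /= inordK.
Qed.

Lemma I4P (P : 'I_4 -> Prop) :
  P (inord 0) -> P (inord 1) -> P (inord 2) -> P (inord 3) -> forall i, P i.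
Proof.
move=> P0 P1 P2 P3 i; rewrite -(inord_val i).
by case: i => [[|[|[|[|//]]]] ?].
Qed.

Lemma rV4P (R : realType) (u v : 'rV[R]_4) :
  u 0 (inord 0) = v 0 (inord 0) -> u 0 (inord 1) = v 0 (inord 1) ->
  u 0 (inord 2) = v 0 (inord 2) -> u 0 (inord 3) = v 0 (inord 3) -> u = v.
Proof. by move=> *; apply/rowP; apply: I4P. Qed.

Definition frame (R : realType) (k : nat) : 'rV[R]_4 := delta_mx 0 (inord k).
Arguments frame {R} k.

Lemma frameE (R : realType) (k j : nat) : (k < 4)%N -> (j < 4)%N ->
  (frame k : 'rV[R]_4) 0 (inord j) = (j == k)%:R.
Proof. by move=> k4 j4; rewrite mxE/= -val_eqE/= !inordK. Qed.

Lemma inner_gf (R : realType) (f : R -> R) (p u v : 'rV[R]_4) :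
  inner (gf f) p u v = - 2 * f (coord_y p) * u 0 (inord 0) * v 0 (inord 0)
    + u 0 (inord 0) * v 0 (inord 2) + u 0 (inord 2) * v 0 (inord 0)
    + u 0 (inord 1) * v 0 (inord 3) + u 0 (inord 3) * v 0 (inord 1).
Proof.
rewrite /inner mxE sum_I4 !mxE !sum_I4 !mxE !inordK//=; ring.
Qed.

Lemma gf_unit (R : realType) (f : R -> R) (p : 'rV[R]_4) : gf f p \in unitmx.
Proof.
(* [H] is the inverse Gram matrix: inversion moves the entry [- 2 f] from the slot of x, x to [2 f]
   in the slot of x~, x~. *)
pose H : 'M[R]_4 := \matrix_(i < 4, j < 4)
  match nat_of_ord i, nat_of_ord j with
  | 2%N, 2%N => 2 * f (coord_y p)
  | 0%N, 2%N | 2%N, 0%N | 1%N, 3%N | 3%N, 1%N => 1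
  | _, _ => 0
  end.
suff /mulmx1_unit[] : gf f p *m H = 1%:M by [].
apply/matrixP => i j; move: i j.
by do 2 apply: I4P; rewrite !mxE sum_I4 !mxE -!val_eqE/= !inordK//=; ring.
Qed.

Lemma inner_delta (R : realType) n (g : 'rV[R]_n -> 'M[R]_n) (p u : 'rV[R]_n) j :
  inner g p u (delta_mx 0 j) = (u *m g p) 0 j.
Proof.
rewrite /inner mxE (bigD1 j)//= big1 ?addr0 => [|k kj].
  by rewrite !mxE !eqxx mulr1.
by rewrite !mxE (negbTE kj) andbF mulr0.
Qed.

(* [nabla_u v = f' *: gamma u v], see [christoffel_gf]. *)
Definition gamma (R : realType) (u v : 'rV[R]_4) : 'rV[R]_4 :=
  (u 0 (inord 0) * v 0 (inord 0)) *: frame 3 -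
  (u 0 (inord 0) * v 0 (inord 1) + u 0 (inord 1) * v 0 (inord 0)) *: frame 2.

Lemma gammaE (R : realType) (u v : 'rV[R]_4) :
  [/\ gamma u v 0 (inord 0) = 0, gamma u v 0 (inord 1) = 0,
      gamma u v 0 (inord 2) =
        - (u 0 (inord 0) * v 0 (inord 1) + u 0 (inord 1) * v 0 (inord 0))
    & gamma u v 0 (inord 3) = u 0 (inord 0) * v 0 (inord 0)].
Proof. by split; rewrite /gamma !mxE -!val_eqE/= !inordK//=; ring. Qed.

Lemma is_derive_coord_y (R : realType) (f : R -> R) (p u : 'rV[R]_4) :
  derivable f (coord_y p) 1 ->
  is_derive p u (fun q => f (coord_y q)) (f^`()%classic (coord_y p) * u 0 (inord 1)).
Proof.
move=> df; apply: is_derive_chain; last exact: is_derive_entry.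
by rewrite derive1E; exact: derivableP.
Qed.

Lemma is_derive_inner_gf (R : realType) (f : R -> R) (p u v w : 'rV[R]_4) :
  derivable f (coord_y p) 1 ->
  is_derive p w (fun q => inner (gf f) q u v)
    (- 2 * f^`()%classic (coord_y p) * w 0 (inord 1) *
       (u 0 (inord 0) * v 0 (inord 0))).
Proof.
move=> df; pose c := u 0 (inord 0) * v 0 (inord 2) + u 0 (inord 2) * v 0 (inord 0)
    + u 0 (inord 1) * v 0 (inord 3) + u 0 (inord 3) * v 0 (inord 1).
rewrite (_ : (fun q => _) =
  (- 2 * (u 0 (inord 0) * v 0 (inord 0))) \*: (fun q => f (coord_y q)) + cst c).
  apply: is_derive_eq.
    by apply: is_deriveD; apply: is_deriveZ; exact: is_derive_coord_y.
  by rewrite addr0 /GRing.scale/=; ring.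
apply/funext => q; rewrite inner_gf /c.
rewrite -[RHS]/(- 2 * (u 0 (inord 0) * v 0 (inord 0)) * f (coord_y q) + c) /c.
by ring.
Qed.

(** As the Gram matrix is invertible, it suffices to compare Koszul's formula with the inner
    products of [f' gamma u v] with the basis vectors. *)
Lemma christoffel_gf (R : realType) (f : R -> R) (p u v : 'rV[R]_4) :
  derivable f (coord_y p) 1 ->
  christoffel (gf f) p u v = f^`()%classic (coord_y p) *: gamma u v.
Proof.
move=> df; rewrite /christoffel.
rewrite (_ : (\row_k _) = (f^`()%classic (coord_y p) *: gamma u v) *m gf f p).
  by rewrite mulmxK// gf_unit.
apply/rowP => j; rewrite -inner_delta mxE /christoffel1.
have D a b c : 'D_a (fun q => inner (gf f) q b c) p =
    - 2 * f^`()%classic (coord_y p) * a 0 (inord 1) * (b 0 (inord 0) * c 0 (inord 0)).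
  by have dI := is_derive_inner_gf b c a df; rewrite derive_val.
rewrite !D inner_gf.
have [G0 G1 G2 G3] := gammaE u v.
rewrite ![(_ *: gamma _ _) _ _]mxE G0 G1 G2 G3; by field.
Qed.

Definition dxdy (R : realType) (u v : 'rV[R]_4) : R :=
  u 0 (inord 0) * v 0 (inord 1) - u 0 (inord 1) * v 0 (inord 0).

(** The tensor [- c w (x) w (x) dy^m] with [w = dx /\ dy]: [lshift] addresses the four curvature
    slots, [rshift] the [m] slots of covariant differentiation. *)
Definition curvature_form (R : realType) m (c : R) (v : 'I_(4 + m) -> 'rV[R]_4) : R :=
  - c * dxdy (v (lshift m (inord 0))) (v (lshift m (inord 1)))
      * dxdy (v (lshift m (inord 2))) (v (lshift m (inord 3)))
      * \prod_(j < m) (v (rshift 4 j)) 0 (inord 1).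

Lemma inord4_eq (i j : nat) : (i < 4)%N -> (j < 4)%N ->
  (inord i == inord j :> 'I_4) = (i == j).
Proof. by move=> i4 j4; rewrite -val_eqE/= !inordK. Qed.

(** Each slot enters through [dx] and [dy] only. This yields multilinearity, and it makes the form
    vanish as soon as one argument is a value of [gamma]. *)
Lemma curvature_form_slot (R : realType) m (c : R) (v : 'I_(4 + m) -> 'rV[R]_4) i :
  exists a b : R, forall u,
    curvature_form c (update v i u) = a * u 0 (inord 0) + b * u 0 (inord 1).
Proof.
have upr k u j : update v (lshift m k) u (rshift 4 j) = v (rshift 4 j).
  by rewrite /update eq_rlshift.
have upl k u j : update v (rshift 4 k) u (lshift m j) = v (lshift m j).
  by rewrite /update eq_lrshift.
have ull k u j : update v (lshift m k) u (lshift m j) =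
    if j == k then u else v (lshift m j).
  by rewrite /update eq_lshift.
have urr k u j : update v (rshift 4 k) u (rshift 4 j) =
    if j == k then u else v (rshift 4 j).
  by rewrite /update eq_rshift.
case: (split_ordP i) => k ->.
  have pr u : \prod_(j < m) (update v (lshift m k) u (rshift 4 j)) 0 (inord 1) =
      \prod_(j < m) (v (rshift 4 j)) 0 (inord 1).
    by apply: eq_bigr => j _; rewrite upr.
  rewrite /curvature_form; set p := \prod_(j < m) _ in pr.
  pose w i := v (lshift m (inord i)).
  move: k pr ull; apply: I4P => pr ull.
  - exists (- c * p * w 1%N 0 (inord 1) * dxdy (w 2%N) (w 3%N)),
           (c * p * w 1%N 0 (inord 0) * dxdy (w 2%N) (w 3%N)) => u.
    rewrite pr !ull !inord4_eq//= -/(w _) -/(w _) -/(w _) /dxdy; ring.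
  - exists (c * p * w 0%N 0 (inord 1) * dxdy (w 2%N) (w 3%N)),
           (- c * p * w 0%N 0 (inord 0) * dxdy (w 2%N) (w 3%N)) => u.
    rewrite pr !ull !inord4_eq//= -/(w _) -/(w _) -/(w _) /dxdy; ring.
  - exists (- c * p * w 3%N 0 (inord 1) * dxdy (w 0%N) (w 1%N)),
           (c * p * w 3%N 0 (inord 0) * dxdy (w 0%N) (w 1%N)) => u.
    rewrite pr !ull !inord4_eq//= -/(w _) -/(w _) -/(w _) /dxdy; ring.
  - exists (c * p * w 2%N 0 (inord 1) * dxdy (w 0%N) (w 1%N)),
           (- c * p * w 2%N 0 (inord 0) * dxdy (w 0%N) (w 1%N)) => u.
    rewrite pr !ull !inord4_eq//= -/(w _) -/(w _) -/(w _) /dxdy; ring.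
exists 0, (- c * dxdy (v (lshift m (inord 0))) (v (lshift m (inord 1)))
      * dxdy (v (lshift m (inord 2))) (v (lshift m (inord 3)))
      * \prod_(j < m | j != k) (v (rshift 4 j)) 0 (inord 1)) => u.
rewrite /curvature_form !upl (bigD1 k)//= urr eqxx.
under eq_bigr => j jk do rewrite urr (negbTE jk).
by ring.
Qed.

Lemma curvature_formZ (R : realType) m (c d : R) (v : 'I_(4 + m) -> 'rV[R]_4) :
  curvature_form (c * d) v = c * curvature_form d v.
Proof. by rewrite /curvature_form; ring. Qed.

Lemma curvature_form_multilinear (R : realType) m (c : R) :
  multilinear (curvature_form c : ('I_(4 + m) -> 'rV[R]_4) -> R).
Proof.
move=> i v; have [a [b ab]] := curvature_form_slot c v i.
by move=> k x y; rewrite !ab !mxE/= /GRing.scale/=; ring.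
Qed.

Lemma curvature_form_pullback (R : realType) m (c t s : R) (L : 'rV[R]_4 -> 'rV[R]_4)
    (v : 'I_(4 + m) -> 'rV[R]_4) :
  (forall u w, dxdy (L u) (L w) = t * dxdy u w) ->
  (forall u, L u 0 (inord 1) = s * u 0 (inord 1)) ->
  curvature_form c (fun j => L (v j)) = curvature_form (c * t ^+ 2 * s ^+ m) v.
Proof.
move=> Lom L1; rewrite /curvature_form !Lom.
under eq_bigr do rewrite L1.
by rewrite big_split/= prodr_const card_ord; ring.
Qed.

Lemma gamma_eq0 (R : realType) (u v : 'rV[R]_4) :
  v 0 (inord 0) = 0 -> v 0 (inord 1) = 0 -> gamma u v = 0.
Proof. by move=> v0 v1; rewrite /gamma v0 v1 !mulr0 addr0 !scale0r subr0. Qed.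

Lemma coord_y_continuous (R : realType) : continuous (@coord_y R).
Proof. by move=> p; exact/differentiable_continuous/differentiable_coord. Qed.

Lemma open_Mf_domain (R : realType) (O : set R) : open O -> open (Mf_domain O).
Proof. by move=> oO; apply: open_comp => // p _; exact: coord_y_continuous. Qed.

(** * The curvature tensor of the metric and its covariant derivatives *)

Section CurvatureMf.
Variables (R : realType) (O : set R) (f : R -> R).
Hypotheses (O_open : open O) (f_analytic : real_analytic O f).

Let derivablefn n a : O a -> derivable f^`(n)%classic a 1.
Proof. by move=> Oa; have [] := derivable_derive1n n f_analytic Oa. Qed.

Lemma near_Mf_domain p : Mf_domain O p -> \forall q \near p, Mf_domain O q.
Proof. by move=> Op; apply: open_nbhs_nbhs; split => //; exact: open_Mf_domain. Qed.

Lemma nabla_const_gf p u v : Mf_domain O p ->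
  nabla (gf f) u (fun=> v) p = f^`()%classic (coord_y p) *: gamma u v.
Proof.
move=> Op; rewrite /nabla christoffel_gf ?derive_cst ?add0r//.
exact: (@derivablefn 0%N _ Op).
Qed.

(** [gamma] takes values in the span of d_x~ and d_y~ and vanishes when its second argument lies
    there, so the only surviving term is the derivative of the coefficient [f']. *)
Lemma nabla_nabla_const_gf p u v w : Mf_domain O p ->
  nabla (gf f) u (nabla (gf f) v (fun=> w)) p =
    (f^`(2)%classic (coord_y p) * u 0 (inord 1)) *: gamma v w.
Proof.
move=> Op; rewrite {1}/nabla.
rewrite (@near_eq_derive _ _ _ _ (fun q => f^`()%classic (coord_y q) *: gamma v w));
  last by near=> q; rewrite nabla_const_gf//; near: q; exact: near_Mf_domain.
rewrite nabla_const_gf// christoffel_gf; last exact: (@derivablefn 0%N _ Op).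
have [G0 G1 _ _] := gammaE v w.
have -> : gamma u (f^`()%classic (coord_y p) *: gamma v w) = 0.
  by rewrite gamma_eq0// mxE ?G0 ?G1 mulr0.
rewrite scaler0 addr0.
have D := is_derive_scalel (gamma v w) (is_derive_coord_y u (@derivablefn 1%N _ Op)).
by rewrite derive_val.
Unshelve. all: by end_near. Qed.

Lemma curvature_tensor_gf p v : Mf_domain O p ->
  curvature_tensor (gf f) p v = curvature_form (m := 0) (f^`(2)%classic (coord_y p)) v.
Proof.
move=> Op; rewrite /curvature_tensor /curvature_op !nabla_nabla_const_gf//.
have lE k : lshift 0 (inord k : 'I_4) = inord k by apply/val_inj.
rewrite /curvature_form big_ord0 !lE mulr1 inner_gf.
have E a b (X Y : 'rV[R]_4) j : (a *: X - b *: Y) 0 j = a * X 0 j - b * Y 0 j.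
  by rewrite !mxE.
rewrite !E !frameE//= /dxdy; ring.
Qed.

(** Induction on [m]: the Christoffel corrections vanish by [curvature_form_slot], and
    differentiating the coefficient [f^(m+2)] along [w] gives [f^(m+3) dy(w)], which is the new last
    slot. *)
Lemma nabla_curvature_gf m p v : Mf_domain O p ->
  nabla_curvature (gf f) m p v = curvature_form (f^`(m.+2)%classic (coord_y p)) v.
Proof.
elim: m p v => [|m IH] p v Op; first exact: curvature_tensor_gf.
rewrite [nabla_curvature _ _ _ _]/= /nabla_tensor.
set w := v ord_max; set v' := fun i : 'I_(4 + m) => _.
rewrite (@near_eq_derive _ _ _ _
  (fun q => f^`(m.+2)%classic (coord_y q) *: curvature_form 1 v')); last first.
  near=> q; rewrite IH; last by near: q; exact: near_Mf_domain.
  by rewrite -{1}[f^`(_)%classic _]mulr1 curvature_formZ.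
rewrite [X in _ - X]big1 ?subr0 => [|i _]; last first.
  rewrite IH// christoffel_gf; last exact: (@derivablefn 0%N _ Op).
  have [a [b ->]] := curvature_form_slot (f^`(m.+2)%classic (coord_y p)) v' i.
  have [G0 G1 _ _] := gammaE w (v' i).
  by rewrite ![(_ *: gamma _ _) _ _]mxE G0 G1 !mulr0 addr0.
have D := is_derive_scalel (curvature_form 1 v')
  (is_derive_coord_y w (@derivablefn m.+2 _ Op)).
rewrite derive_val -derive1nS -[in RHS](mulr1 (f^`(_)%classic _)) curvature_formZ.
rewrite /GRing.scale/= -mulrA; congr (_ * _).
rewrite /curvature_form big_ord_recr/=.
have -> : v (rshift 4 ord_max) = w by congr v; apply/val_inj.
have lE k : v' (lshift m (inord k)) = v (lshift m.+1 (inord k)).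
  by congr v; apply/val_inj.
rewrite !lE (eq_bigr (fun j => v (rshift 4 (widen_ord (leqnSn m) j)) 0 (inord 1))).
  by ring.
by move=> j _; congr (v _ _ _); apply/val_inj.
Unshelve. all: by end_near. Qed.

End CurvatureMf.

(** * Curvature homogeneity and the differential equation for [f] *)

(** The test arguments [a, b, a, b, b, .., b], on which [curvature_form] becomes a monomial in
    [dxdy a b] and [dy(b)]. *)
Definition alternate (T : Type) m (a b : T) : 'I_(4 + m) -> T :=
  fun j => if (nat_of_ord j == 0%N) || (nat_of_ord j == 2%N) then a else b.

Lemma curvature_form_alternate (R : realType) m (c : R) (a b : 'rV[R]_4) :
  curvature_form c (@alternate _ m a b) = - c * dxdy a b ^+ 2 * (b 0 (inord 1)) ^+ m.
Proof.
rewrite /curvature_form /alternate /= !inordK//=.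
rewrite prodr_const card_ord; ring.
Qed.

(** The factors cancel: [(t^2 s^2) t^2 = (t^2 s)^2]. That [b] is nonzero forces [b'], [t] and [s] to
    be nonzero. *)
Lemma weighted_ratio (K : fieldType) (a b c a' b' c' t s : K) :
  a = a' * t ^+ 2 * s ^+ 0 -> b = b' * t ^+ 2 * s ^+ 1 ->
  c = c' * t ^+ 2 * s ^+ 2 -> b != 0 ->
  c * a * b ^- 2 = c' * a' * b' ^- 2.
Proof.
move=> -> -> ->; rewrite !mulf_eq0 !negb_or expr1 => /andP[/andP[b0 /andP[t0 _]] s0].
by field; rewrite b0 s0 t0.
Qed.

(** Through the common model, the tangent spaces at two points are identified compatibly with [R],
    [nabla R] and [nabla^2 R]; evaluation on d_x, d_y then relates the derivatives of [f] as
    [weighted_ratio] requires. *)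
Lemma alpha2_constant (R : realType) (O : set R) (f : R -> R) :
  open O -> real_analytic O f ->
  (forall y, O y -> 0 < f^`(2)%classic y) ->
  (forall y, O y -> 0 < f^`(3)%classic y) ->
  curvature_homogeneous 2 (Mf_domain O) (gf f) ->
  exists k : R, forall y, O y -> alpha2 f y = k.
Proof.
move=> oO fO f2 f3 [V [ip [A [_ _ _ hom]]]].
have [[y0 Oy0]|O0] := pselect (exists y, O y); last first.
  by exists 0 => y Oy; case: O0; exists y.
exists (alpha2 f y0) => y Oy.
pose pt z : 'rV[R]_4 := z *: frame 1.
have cpt z : coord_y (pt z) = z by rewrite /coord_y mxE frameE// mulr1.
have Dpt z : O z -> Mf_domain O (pt z) by rewrite /Mf_domain/= cpt.
have [P [_ _ PA]] := hom _ (Dpt _ Oy).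
have [Q [[Q' _ QK] _ QA]] := hom _ (Dpt _ Oy0).
(* The images of d_x and d_y in the tangent space over [y0]; the two factors are [t = dxdy u0 u1]
   and [s = dy(u1)]. *)
pose u0 := Q' (P (frame 0)); pose u1 := Q' (P (frame 1)).
have key (i : 'I_3) : f^`(i.+2)%classic y =
    f^`(i.+2)%classic y0 * dxdy u0 u1 ^+ 2 * (u1 0 (inord 1)) ^+ i.
  have := PA i (alternate (frame 0) (frame 1)).
  have -> : (fun j => P (@alternate _ i (frame 0) (frame 1) j)) =
            (fun j => Q (@alternate _ i u0 u1 j)).
    by apply/funext => j; rewrite /alternate; case: ifP; rewrite QK.
  rewrite QA !(nabla_curvature_gf oO fO) ?cpt; [|exact: Dpt..].
  move: (f^`(i.+2)%classic y) (f^`(i.+2)%classic y0) => F G.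
  rewrite !curvature_form_alternate.
  have -> : dxdy (frame 0 : 'rV[R]_4) (frame 1) = 1 by rewrite /dxdy !frameE//=; ring.
  by rewrite frameE// eqxx !expr1n !mulr1 !mulNr => /oppr_inj/esym.
have E n (n3 : (n < 3)%N) : f^`(n.+2)%classic y =
    f^`(n.+2)%classic y0 * dxdy u0 u1 ^+ 2 * (u1 0 (inord 1)) ^+ n.
  exact: key (Ordinal n3).
apply: weighted_ratio (E 0%N isT) (E 1%N isT) (E 2%N isT) _; apply: lt0r_neq0.
exact: f3.
Qed.

(** * Solving the differential equation given by constant [alpha_2] *)

Lemma derive0_constant (R : realType) (O : set R) (g : R -> R) :
  connected O -> (forall y, O y -> is_derive y 1 g 0) ->
  exists C : R, forall y, O y -> g y = C.
Proof.
move=> /connected_intervalP iO dg.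
have [[y0 Oy0]|O0] := pselect (exists y, O y); last first.
  by exists 0 => y Oy; case: O0; exists y.
have key x y : O x -> O y -> x < y -> g x = g y.
  move=> Ox Oy xy.
  have sub z : z \in `[x, y]%R -> O z by rewrite in_itv/=; exact: iO.
  have [||c _] := @MVT _ g (fun=> 0) x y xy.
  - by move=> z /subset_itv_oo_cc /sub/dg.
  - by apply: derivable_within_continuous => z /sub/dg[].
  - by rewrite mul0r => /eqP; rewrite subr_eq0 => /eqP.
exists (g y0) => y Oy; case: (ltgtP y y0) => [yy0|yy0|->//].
  exact: key.
exact/esym/key.
Qed.

Lemma is_derive_mulf (R : realType) (V : normedModType R) (F G : V -> R) x v a b :
  is_derive x v F a -> is_derive x v G b ->
  is_derive x v (fun z => F z * G z) (a * G x + F x * b).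
Proof.
move=> dF dG; rewrite (_ : (fun z => _) = F * G); last exact/funext.
by apply: is_derive_eq (is_deriveM dF dG) _; rewrite addrC [_ *: a]mulrC.
Qed.

Lemma is_derive_subf (R : realType) (V : normedModType R) (F G : V -> R) x v a b :
  is_derive x v F a -> is_derive x v G b ->
  is_derive x v (fun z => F z - G z) (a - b).
Proof.
by move=> dF dG; rewrite (_ : (fun z => _) = F - G)//; exact: is_deriveB.
Qed.

Lemma is_derive_mulcf (R : realType) (V : normedModType R) (F : V -> R) (c : R) x v a :
  is_derive x v F a -> is_derive x v (fun z => c * F z) (c * a).
Proof.
by move=> dF; rewrite (_ : (fun z => _) = c \*: F)//; exact: is_deriveZ.
Qed.

(* [h / h'] has derivative [1 - k], so it is affine; the two forms are those of
   the solutions of [h / h' = (1 - k) y + D]. *)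
Lemma power_or_exponential (R : realType) (O : set R) (h h1 h2 : R -> R) (k : R) :
  connected O ->
  (forall y, O y -> is_derive y 1 h (h1 y)) ->
  (forall y, O y -> is_derive y 1 h1 (h2 y)) ->
  (forall y, O y -> 0 < h y) -> (forall y, O y -> 0 < h1 y) ->
  (forall y, O y -> h2 y * h y * h1 y ^- 2 = k) ->
  power_form O h \/ exponential_form O h.
Proof.
move=> cO dh dh1 h_gt0 h1_gt0 kE.
pose q y := h y / h1 y.
have q_gt0 y : O y -> 0 < q y by move=> Oy; rewrite divr_gt0 ?h_gt0 ?h1_gt0.
have dq y : O y -> is_derive y 1 q (1 - k).
  move=> Oy; have h1_gt0y : h1 y != 0 by rewrite lt0r_neq0 ?h1_gt0.
  have d1 := dh _ Oy; have d2 := dh1 _ Oy.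
  have d3 : is_derive y 1 (fun z => (h1 z)^-1)
      (- (h1 y) ^- 2 *: h2 y) by exact: is_deriveV.
  apply: is_derive_eq (is_derive_mulf d1 d3) _.
  by rewrite -(kE _ Oy) /GRing.scale/=; field.
have [D DE] : exists D, forall y, O y -> q y - (1 - k) * y = D.
  apply: derive0_constant => // y Oy.
  have d1 := dq _ Oy.
  apply: is_derive_eq (is_derive_subf d1 (is_derive_mulcf (1 - k) (is_derive_id y 1))) _.
  by rewrite mulr1 subrr.
have dln (g : R -> R) (dg y : R) : 0 < g y -> is_derive y 1 g dg ->
    is_derive y 1 (fun z => ln (g z)) ((g y)^-1 * dg).
  by move=> gy ?; apply: is_derive_chain; exact: is_derive1_ln.
have [k1|k1] := eqVneq k 1.
  right; have qD y : O y -> q y = D.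
    by move=> Oy; rewrite -(DE _ Oy) k1 subrr mul0r subr0.
  (* Here [h' / h = 1 / q] is the constant [D^-1], so [ln h] is affine with this slope. *)
  have [C CE] : exists C, forall y, O y -> ln (h y) - D^-1 * y = C.
    apply: derive0_constant => // y Oy.
    have d1 := dln _ _ _ (h_gt0 _ Oy) (dh _ Oy).
    apply: is_derive_eq (is_derive_subf d1 (is_derive_mulcf D^-1 (is_derive_id y 1))) _.
    rewrite -(qD _ Oy) /q invf_div mulr1 mulrC subrr//.
  exists (expR C), D^-1 => y Oy.
  by rewrite -expRD -(CE _ Oy) subrK lnK// posrE h_gt0.
left.
have k10 : 1 - k != 0 by rewrite subr_eq0 eq_sym.
pose c := (1 - k)^-1.
(* Since [q' = 1 - k], both [ln h] and [c ln q] have derivative [1 / q]. *)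
have [C CE] : exists C, forall y, O y -> ln (h y) - c * ln (q y) = C.
  apply: derive0_constant => // y Oy.
  have d1 := dln _ _ _ (h_gt0 _ Oy) (dh _ Oy).
  have d2 := dln _ _ _ (q_gt0 _ Oy) (dq _ Oy).
  apply: is_derive_eq (is_derive_subf d1 (is_derive_mulcf c d2)) _.
  rewrite /c /q; field.
  by rewrite k10 !gt_eqF ?h_gt0 ?h1_gt0.
exists (expR C * `|1 - k| `^ c), (D / (1 - k)), c => y Oy.
(* The sign of [1 - k] is unknown; the absolute values may be inserted because [q] is positive. *)
have qE : q y = `|1 - k| * `|y + D / (1 - k)|.
  rewrite -normrM -[LHS]gtr0_norm ?q_gt0//; congr (`|_|).
  by rewrite -(DE _ Oy); field.
rewrite -mulrA -powRM// -qE /powR gt_eqF ?q_gt0//.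
by rewrite -expRD -(CE _ Oy) subrK lnK// posrE h_gt0.
Qed.

(** * Explicit isometries *)

(** A class of polynomial functions given by its closure rules. It is stable under directional
    derivatives, so smoothness of the explicit isometries follows by induction on the order. *)
Inductive polyfun (R : realType) n : ('rV[R]_n -> R) -> Prop :=
| polyfun_cst c : polyfun (fun=> c)
| polyfun_entry j : polyfun (fun p => p 0 j)
| polyfun_add F G : polyfun F -> polyfun G -> polyfun (fun p => F p + G p)
| polyfun_mul F G : polyfun F -> polyfun G -> polyfun (fun p => F p * G p).

Inductive polymap (R : realType) n (W : normedModType R) : ('rV[R]_n -> W) -> Prop :=
| polymap_scale F w : polyfun F -> polymap (fun p => F p *: w)
| polymap_add F G : polymap F -> polymap G -> polymap (fun p => F p + G p).

Lemma polyfun_differentiable (R : realType) n (F : 'rV[R]_n -> R) x :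
  polyfun F -> differentiable F x.
Proof.
elim=> [c|j|{}F G _ dF _ dG|{}F G _ dF _ dG].
- exact: differentiable_cst.
- exact: differentiable_coord.
- exact: (differentiableD dF dG).
- exact: (differentiableM dF dG).
Qed.

Lemma polyfun_derive (R : realType) n (F : 'rV[R]_n -> R) v :
  polyfun F -> polyfun ('D_v F).
Proof.
elim=> [c|j|{}F G pF dF pG dG|{}F G pF dF pG dG].
- rewrite (_ : 'D_v _ = fun=> 0); first exact: polyfun_cst.
  by apply/funext => x; exact: derive_cst.
- rewrite (_ : 'D_v _ = fun=> v 0 j); first exact: polyfun_cst.
  by apply/funext => x; have D := is_derive_entry x v 0 j; rewrite derive_val.
- rewrite (_ : 'D_v _ = fun p => 'D_v F p + 'D_v G p); first exact: polyfun_add.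
  apply/funext => x; apply: (@deriveD _ _ _ F G);
  exact/diff_derivable/polyfun_differentiable.
- rewrite (_ : 'D_v _ = fun p => F p * 'D_v G p + G p * 'D_v F p).
    by apply: polyfun_add; apply: polyfun_mul.
  apply/funext => x; apply: (@deriveM _ _ F G);
  exact/diff_derivable/polyfun_differentiable.
Qed.

Lemma polymap_differentiable (R : realType) n (W : normedModType R)
  (F : 'rV[R]_n -> W) x : polymap F -> differentiable F x.
Proof.
elim=> [{}F w pF|{}F G _ dF _ dG]; last exact: (differentiableD dF dG).
exact/differentiableZl/polyfun_differentiable.
Qed.

Lemma polymap_derive (R : realType) n (W : normedModType R)
  (F : 'rV[R]_n -> W) v : polymap F -> polymap ('D_v F).
Proof.
elim=> [{}F w pF|{}F G pF dF pG dG].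
  rewrite (_ : 'D_v _ = fun p => 'D_v F p *: w).
    exact/polymap_scale/polyfun_derive.
  apply/funext => x.
  have dF : is_derive x v F ('D_v F x).
    exact/derivableP/diff_derivable/polyfun_differentiable.
  by have D := is_derive_scalel w dF; rewrite derive_val.
rewrite (_ : 'D_v _ = fun p => 'D_v F p + 'D_v G p); first exact: polymap_add.
apply/funext => x; apply: (@deriveD _ _ _ F G);
exact/diff_derivable/polymap_differentiable.
Qed.

Lemma polymap_smooth (R : realType) n (W : normedModType R) U
  (F : 'rV[R]_n -> W) : polymap F -> smooth U F.
Proof.
move=> pF k; elim: k F pF => [//|k IH] F pF; split => [x _|v].
  exact: polymap_differentiable.
exact/IH/polymap_derive.
Qed.

Definition row4 (R : realType) (a b c d : R) : 'rV[R]_4 :=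
  a *: frame 0 + b *: frame 1 + c *: frame 2 + d *: frame 3.

Lemma row4E (R : realType) (a b c d : R) :
  (row4 a b c d 0 (inord 0) = a) * (row4 a b c d 0 (inord 1) = b) *
  (row4 a b c d 0 (inord 2) = c) * (row4 a b c d 0 (inord 3) = d).
Proof.
have E j : row4 a b c d 0 j = a * (frame 0 : 'rV[R]_4) 0 j + b * (frame 1 : 'rV[R]_4) 0 j
    + c * (frame 2 : 'rV[R]_4) 0 j + d * (frame 3 : 'rV[R]_4) 0 j by rewrite !mxE.
by do ![split]; rewrite E !frameE//=; ring.
Qed.

Lemma is_derive_row4 (R : realType) (V : normedModType R) (F0 F1 F2 F3 : V -> R)
    x v a b c d :
  is_derive x v F0 a -> is_derive x v F1 b -> is_derive x v F2 c ->
  is_derive x v F3 d ->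
  is_derive x v (fun p => row4 (F0 p) (F1 p) (F2 p) (F3 p)) (row4 a b c d).
Proof.
move=> d0 d1 d2 d3.
have D := is_deriveD (is_deriveD (is_deriveD (is_derive_scalel (frame 0) d0)
  (is_derive_scalel (frame 1) d1)) (is_derive_scalel (frame 2) d2))
  (is_derive_scalel (frame 3) d3).
exact: D.
Qed.

Lemma polymap_row4 (R : realType) n (F0 F1 F2 F3 : 'rV[R]_n -> R) :
  polyfun F0 -> polyfun F1 -> polyfun F2 -> polyfun F3 ->
  polymap (fun p => row4 (F0 p) (F1 p) (F2 p) (F3 p)).
Proof.
by move=> p0 p1 p2 p3; do 3 (apply: polymap_add; last exact: polymap_scale);
  exact: polymap_scale.
Qed.

Section ScalingIsometry.
Variables (R : realType) (r s b c0 c2 c3 m q : R).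

(* The terms in [m] and [q] absorb the affine part of
   [r ^+ 2 * f (s * y + b) - f y]. *)
Definition scaling_map (p : 'rV[R]_4) : 'rV[R]_4 :=
  row4 (r * p 0 (inord 0) + c0) (s * p 0 (inord 1) + b)
    (r^-1 * (p 0 (inord 2) + (m * p 0 (inord 1) + q) * p 0 (inord 0)) + c2)
    (s^-1 * (p 0 (inord 3) + (- m / 2) * (p 0 (inord 0) * p 0 (inord 0))) + c3).

Definition scaling_inv (p : 'rV[R]_4) : 'rV[R]_4 :=
  row4 (r^-1 * (p 0 (inord 0) + - c0)) (s^-1 * (p 0 (inord 1) + - b))
    (r * (p 0 (inord 2) + - c2) +
       (- m * (s^-1 * (p 0 (inord 1) + - b)) + - q) * (r^-1 * (p 0 (inord 0) + - c0)))
    (s * (p 0 (inord 3) + - c3) +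
       m / 2 * (r^-1 * (p 0 (inord 0) + - c0) * (r^-1 * (p 0 (inord 0) + - c0)))).

Hypotheses (r0 : r != 0) (s0 : s != 0).

Lemma scaling_mapK : cancel scaling_map scaling_inv.
Proof.
move=> p; rewrite /scaling_inv /scaling_map !row4E.
by apply: rV4P; rewrite !row4E; field; rewrite ?r0 ?s0.
Qed.

Lemma scaling_invK : cancel scaling_inv scaling_map.
Proof.
move=> p; rewrite /scaling_map /scaling_inv !row4E.
by apply: rV4P; rewrite !row4E; field; rewrite ?r0 ?s0.
Qed.

Lemma scaling_map_polymap : polymap scaling_map.
Proof.
apply: polymap_row4; repeat (apply: polyfun_add || apply: polyfun_mul ||
  apply: polyfun_entry || apply: polyfun_cst).
Qed.

Lemma scaling_inv_polymap : polymap scaling_inv.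
Proof.
apply: polymap_row4; repeat (apply: polyfun_add || apply: polyfun_mul ||
  apply: polyfun_entry || apply: polyfun_cst).
Qed.

Lemma scaling_map_y p : coord_y (scaling_map p) = s * coord_y p + b.
Proof. by rewrite /coord_y row4E. Qed.

Lemma scaling_inv_y p : coord_y (scaling_inv p) = s^-1 * (coord_y p + - b).
Proof. by rewrite /coord_y row4E. Qed.

(** In the pulled back metric the x~ component adds [2 (m y + q) dx^2 + 2 m x dx dy]. The first term
    turns [- 2 r^2 f(s y + b)] into [- 2 f(y)]; the second cancels against the quadratic term of the
    y~ component. *)
Lemma scaling_map_isometry (f : R -> R) p u v :
  r ^+ 2 * f (s * coord_y p + b) - f (coord_y p) = m * coord_y p + q ->
  inner (gf f) (scaling_map p) ('d scaling_map p u) ('d scaling_map p v) =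
  inner (gf f) p u v.
Proof.
move=> fE.
have D w : 'd scaling_map p w = row4 (r * w 0 (inord 0)) (s * w 0 (inord 1))
    (r^-1 * (w 0 (inord 2) + (m * w 0 (inord 1) * p 0 (inord 0) +
      (m * p 0 (inord 1) + q) * w 0 (inord 0))))
    (s^-1 * (w 0 (inord 3) + (- m * p 0 (inord 0) * w 0 (inord 0)))).
  rewrite -deriveE; last exact/polymap_differentiable/scaling_map_polymap.
  have e k := is_derive_entry p w 0 (inord k).
  have addc F d (c : R) : is_derive p w F d -> is_derive p w (fun z => F z + c) d.
    move=> dF; rewrite -[d]addr0.
    exact: (is_deriveD dF (is_derive_cst c p w)).
  have add F G d d' : is_derive p w F d -> is_derive p w G d' ->
      is_derive p w (fun z => F z + G z : R) (d + d').
    by move=> dF dG; exact: (is_deriveD dF dG).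
  have D := is_derive_row4 (addc _ _ c0 (is_derive_mulcf r (e 0%N)))
    (addc _ _ b (is_derive_mulcf s (e 1%N)))
    (addc _ _ c2 (is_derive_mulcf r^-1 (add _ _ _ _ (e 2%N)
      (is_derive_mulf (addc _ _ q (is_derive_mulcf m (e 1%N))) (e 0%N)))))
    (addc _ _ c3 (is_derive_mulcf s^-1 (add _ _ _ _ (e 3%N)
      (is_derive_mulcf (- m / 2) (is_derive_mulf (e 0%N) (e 0%N)))))).
  rewrite (@derive_val _ _ _ _ _ _ _ D); congr row4; by field.
have fE' : f (coord_y p) = r ^+ 2 * f (s * coord_y p + b) - (m * coord_y p + q).
  by rewrite -fE opprB addrC subrK.
rewrite !inner_gf !D scaling_map_y fE'.
rewrite !row4E /coord_y; set F := f _.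
by field; rewrite r0 s0.
Qed.

End ScalingIsometry.

(** * Local homogeneity from the self-similarity of [f''] *)

Lemma open_affine_preimage (R : realType) (O : set R) (s b : R) :
  open O -> open [set y | O (s * y + b)].
Proof.
move=> oO; apply: (@open_comp _ _ (fun y : R => s * y + b)) => // y _.
by apply: continuousD; [exact: mulrl_continuous | exact: cvg_cst].
Qed.

Lemma affine_of_derive (R : realType) (O : set R) (H H1 : R -> R) :
  connected O -> (forall y, O y -> is_derive y 1 H (H1 y)) ->
  (forall y, O y -> is_derive y 1 H1 0) ->
  exists m q : R, forall y, O y -> H y = m * y + q.
Proof.
move=> cO dH dH1; have [m mE] := derive0_constant cO dH1.
have [|q qE] := @derive0_constant _ O (fun y => H y - m * y) cO.
  move=> y Oy; have D := is_derive_subf (dH _ Oy) (is_derive_mulcf m (is_derive_id y 1)).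
  by apply: is_derive_eq D _; rewrite mulr1 mE// subrr.
by exists m, q => y Oy; rewrite -(qE _ Oy) addrC subrK.
Qed.

(** By hypothesis the second derivative of the defect vanishes on [O'], the set where both [y] and
    [s y + b] lie in [O]. This is again an interval, whatever the sign of [s]. *)
Lemma scaling_defect (R : realType) (O : set R) (f : R -> R) (r s b : R) :
  connected O -> real_analytic O f ->
  (forall y, O y -> O (s * y + b) ->
     r ^+ 2 * s ^+ 2 * f^`(2)%classic (s * y + b) = f^`(2)%classic y) ->
  exists m q : R, forall y, O y -> O (s * y + b) ->
    r ^+ 2 * f (s * y + b) - f y = m * y + q.
Proof.
move=> /connected_intervalP iO fO f2E.
pose O' := O `&` [set y | O (s * y + b)].
have cO' : connected O'.
  apply/connected_intervalP => x y [Ox Ox'] [Oy Oy'] z /andP[xz zy].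
  split; first by apply: (iO x y) => //; rewrite xz.
  have [s0|s0] := leP 0 s.
    by apply: (iO _ _ Ox' Oy'); rewrite !lerD2r !ler_wpM2l.
  by apply: (iO _ _ Oy' Ox'); rewrite !lerD2r !ler_wnM2l// ltW.
have daff (y : R) : is_derive y 1 (fun z : R => s * z + b) s.
  apply: is_derive_eq (is_deriveD (is_derive_mulcf s (is_derive_id y 1))
    (is_derive_cst b y 1)) _.
  by rewrite mulr1 addr0.
have dcomp (g g1 : R -> R) (y : R) : is_derive (s * y + b) 1 g (g1 (s * y + b)) ->
    is_derive y 1 (fun z => g (s * z + b)) (g1 (s * y + b) * s).
  by move=> dg; apply: is_derive_chain.
have d n y (Oy : O y) := derivable_derive1n n fO Oy.
have [||m [q mqE]] := @affine_of_derive _ O'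
  (fun y => r ^+ 2 * f^`(0)%classic (s * y + b) - f^`(0)%classic y)
  (fun y => r ^+ 2 * (f^`(1)%classic (s * y + b) * s) - f^`(1)%classic y) cO'.
- move=> y [Oy Oy'].
  exact: (is_derive_subf (is_derive_mulcf (r ^+ 2) (dcomp _ _ _ (d 0%N _ Oy')))
    (d 0%N _ Oy)).
- move=> y [Oy Oy'].
  apply: is_derive_eq (is_derive_subf (is_derive_mulcf (r ^+ 2) (is_derive_mulf
    (dcomp _ _ _ (d 1%N _ Oy')) (is_derive_cst s y 1))) (d 1%N _ Oy)) _.
  by rewrite mulr0 addr0 -[cst s y]/s -(f2E _ Oy Oy'); set F := f^`(2)%classic _; ring.
by exists m, q => y Oy Oy'; rewrite -mqE.
Qed.

(** The metric depends on y alone, so translations in the other coordinates are free and it is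
    enough to carry [y0] to [y1]. *)
Lemma scaling_homogeneous (R : realType) (O : set R) (f : R -> R) :
  open O -> connected O -> real_analytic O f ->
  (forall y0 y1, O y0 -> O y1 -> exists r s b : R,
     [/\ r != 0, s != 0, s * y0 + b = y1 &
      forall y, O y -> O (s * y + b) ->
        r ^+ 2 * s ^+ 2 * f^`(2)%classic (s * y + b) = f^`(2)%classic y]) ->
  locally_homogeneous (Mf_domain O) (gf f).
Proof.
move=> oO cO fO hyp P Q OP OQ.
have [r [s [b [r0 s0 sb f2E]]]] := hyp _ _ OP OQ.
have [m [q mqE]] := scaling_defect cO fO f2E.
(* The three translations are read off from the requirement that [phi P = Q]. *)
pose c0 := Q 0 (inord 0) - r * P 0 (inord 0).
pose c2 := Q 0 (inord 2) -
  r^-1 * (P 0 (inord 2) + (m * P 0 (inord 1) + q) * P 0 (inord 0)).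
pose c3 := Q 0 (inord 3) -
  s^-1 * (P 0 (inord 3) + (- m / 2) * (P 0 (inord 0) * P 0 (inord 0))).
pose phi := scaling_map r s b c0 c2 c3 m q.
pose psi := scaling_inv r s b c0 c2 c3 m q.
have PQ : phi P = Q.
  by apply: rV4P; rewrite !row4E ?(addrC _ c0) ?(addrC _ c2) ?(addrC _ c3) ?subrK//.
pose A := Mf_domain (O `&` [set y | O (s * y + b)]).
pose B := Mf_domain (O `&` [set y | O (s^-1 * y + - (s^-1 * b))]).
have psiy p : coord_y (psi p) = s^-1 * coord_y p + - (s^-1 * b).
  by rewrite scaling_inv_y mulrDr mulrN.
have phiB : phi @` A = B.
  apply/seteqP; split => [_ [p [Op Op'] <-]|p [Op Op']].
    split; rewrite /= scaling_map_y//.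
    by rewrite mulrDr mulKf// addrK.
  exists (psi p); last exact: scaling_invK.
  split; rewrite /= psiy//.
  by rewrite mulrDr mulrN !mulVKf// subrK.
exists A, B, phi; split => //.
- split; last by move=> p [].
  split; first by apply: open_Mf_domain; apply: openI => //; exact: open_affine_preimage.
  by split => //=; rewrite sb.
- split; last by move=> p [].
  split; first by apply: open_Mf_domain; apply: openI => //; exact: open_affine_preimage.
  rewrite -phiB -PQ; exists P => //.
  by split => //=; rewrite sb.
- split => //.
  + exact/polymap_smooth/scaling_map_polymap.
  + exists psi; split; first by move=> x _; exact: scaling_mapK.
    exact/polymap_smooth/scaling_inv_polymap.
  + by move=> x [Ox Ox'] u v; apply: scaling_map_isometry => //; exact: mqE.
Qed.

Lemma exponential_homogeneous (R : realType) (O : set R) (f : R -> R) :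
  open O -> connected O -> real_analytic O f ->
  exponential_form O f^`(2)%classic -> locally_homogeneous (Mf_domain O) (gf f).
Proof.
move=> oO cO fO [a [l hE]]; apply: scaling_homogeneous => // y0 y1 Oy0 Oy1.
(* Translation by [y1 - y0] multiplies [f''] by [expR (l * (y1 - y0))]; [r] is the inverse square
   root of this factor. *)
exists (expR (- (l * (y1 - y0)) / 2)), 1, (y1 - y0); split.
- by rewrite gt_eqF// expR_gt0.
- exact: oner_neq0.
- by rewrite mul1r addrC subrK.
move=> y Oy Oy'; rewrite !hE// mul1r expr1n mulr1 mulrCA; congr (_ * _).
by rewrite expr2 -!expRD; congr expR; field.
Qed.

(** The dilation about [- b] that takes [y0] to [y1] multiplies [f''] by [s^c]. Its ratio [s] is
    positive because [y + b] has no zero on the interval [O]. *)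
Lemma power_homogeneous (R : realType) (O : set R) (f : R -> R) :
  open O -> connected O -> real_analytic O f ->
  (forall y, O y -> 0 < f^`(2)%classic y) ->
  (forall y, O y -> 0 < f^`(3)%classic y) ->
  power_form O f^`(2)%classic -> locally_homogeneous (Mf_domain O) (gf f).
Proof.
move=> oO cO fO f2 f3 [a [b [c hE]]].
have nz y : O y -> y + b != 0.
  move=> Oy; apply/eqP => yb.
  (* A power with base 0 is 0 unless [c = 0], and [f'' = 0] is excluded. With [c = 0], however,
     [f''] is constant, against [f''' > 0]. *)
  have c0 : c = 0.
    have := f2 _ Oy; rewrite hE// yb normr0 /powR eqxx.
    by case: eqP => // _; rewrite mulr0 ltxx.
  have [d] := derivable_derive1n 2 fO Oy.
  rewrite (@near_eq_derive _ _ _ _ (cst a)) ?derive_cst.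
    by move=> d3; have := f3 _ Oy; rewrite -d3 ltxx.
  near=> z; rewrite hE; last by near: z; exact: open_nbhs_nbhs.
  by rewrite c0 powRr0 mulr1.
apply: scaling_homogeneous => // y0 y1 Oy0 Oy1.
pose s := (y1 + b) / (y0 + b).
have s_gt0 : 0 < s.
  (* If [y0 + b] and [y1 + b] had opposite signs, [- b] would lie between [y0] and [y1], hence in
     [O]. *)
  rewrite ltNge; apply/negP => s_le0.
  have O_b : O (- b).
    move/connected_intervalP : cO => iO.
    have := nz _ Oy0; have := nz _ Oy1; move: s_le0; rewrite /s.
    have [p0|p0|p0] := ltgtP 0 (y0 + b); last by [].
      rewrite pmulr_lle0 ?invr_gt0// => p1 _ _.
      by apply: (iO _ _ Oy1 Oy0); lra.
    rewrite nmulr_lle0 ?invr_lt0// => p1 _ _.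
    by apply: (iO _ _ Oy0 Oy1); lra.
  by have := nz _ O_b; rewrite addNr eqxx.
pose K := s `^ c.
have K_gt0 : 0 < K by exact: powR_gt0.
(* Chosen so that [r^2 s^2 s^c = 1]. *)
exists (Num.sqrt (s ^+ 2 * K))^-1, s, (s * b - b); split.
- by rewrite invr_eq0 sqrtr_eq0 -ltNge mulr_gt0// exprn_gt0.
- by rewrite gt_eqF.
- by rewrite addrA -mulrDr divfK ?addrK// nz.
move=> y Oy Oy'; rewrite !hE// addrA subrK -mulrDr normrM powRM// (gtr0_norm s_gt0) -/K.
rewrite exprVn sqr_sqrtr; last by rewrite mulr_ge0 ?exprn_ge0// ltW.
by field; rewrite !gt_eqF.
Unshelve. all: by end_near. Qed.

(** * Symmetry of second derivatives *)

(** The mean value theorem twice: along [u] for the difference of [F] on two parallel segments, then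
    along [v] for ['D_u F]. *)
Lemma second_difference (R : realType) (V : normedModType R) (F : V -> R)
    (x u v : V) (h : R) : 0 < h ->
  (forall s t : R, 0 <= s <= h -> 0 <= t <= h ->
     derivable F (x + s *: u + t *: v) u /\
     derivable ('D_u F) (x + s *: u + t *: v) v) ->
  exists s t : R, [/\ 0 <= s <= h, 0 <= t <= h &
    F (x + h *: u + h *: v) - F (x + h *: u) - (F (x + h *: v) - F x) =
    'D_v ('D_u F) (x + s *: u + t *: v) * h ^+ 2].
Proof.
move=> h0 dF.
have h00 : 0 <= (0 : R) <= h by rewrite lexx ltW.
have hhh : 0 <= h <= h by rewrite lexx ltW.
have d1 (s t : R) : s \in `[0, h]%R -> 0 <= t <= h ->
    is_derive s 1 (fun z : R => F (x + t *: v + z *: u)) ('D_u F (x + t *: v + s *: u)).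
  rewrite in_itv/= => sh th; apply: is_derive_line.
  by have [+ _] := dF s t sh th; rewrite addrAC.
have d1' (s : R) : s \in `[0, h]%R ->
    is_derive s 1 (fun z : R => F (x + h *: v + z *: u) - F (x + 0 *: v + z *: u))
      ('D_u F (x + h *: v + s *: u) - 'D_u F (x + 0 *: v + s *: u)).
  by move=> sh; apply: is_derive_subf; exact: d1.
have [|s sh sE] := MVT h0 (fun z zh => d1' z (subset_itv_oo_cc zh)).
  by apply: derivable_within_continuous => z /d1'[].
have {}sh : 0 <= s <= h by have := subset_itv_oo_cc sh; rewrite in_itv.
have d2 (t : R) : t \in `[0, h]%R ->
    is_derive t 1 (fun z : R => 'D_u F (x + s *: u + z *: v))
      ('D_v ('D_u F) (x + s *: u + t *: v)).
  by rewrite in_itv/= => th; apply: is_derive_line; have [] := dF s t sh th.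
have [|t th tE] := MVT h0 (fun z zh => d2 z (subset_itv_oo_cc zh)).
  by apply: derivable_within_continuous => z /d2[].
have {}th : 0 <= t <= h by have := subset_itv_oo_cc th; rewrite in_itv.
exists s, t; split => //.
move: sE tE; rewrite !scale0r !addr0 !subr0 => sE tE.
by rewrite (addrAC x) sE expr2 mulrA -tE (addrAC x).
Qed.

(* Both mixed derivatives occur, at points tending to [x], as the same second
   difference quotient. *)
Lemma derive_derive_comm (R : realType) (V : normedModType R) (F : V -> R)
    (x u v : V) :
  (\forall y \near x, [/\ derivable F y u, derivable F y v,
     derivable ('D_u F) y v & derivable ('D_v F) y u]) ->
  {for x, continuous ('D_v ('D_u F))} -> {for x, continuous ('D_u ('D_v F))} ->
  'D_v ('D_u F) x = 'D_u ('D_v F) x.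
Proof.
have far (a b q e : R) : `|a - q| < e -> `|b - q| < e -> `|a - b| = e + e -> False.
  by move=> aq bq ab; have := ler_distD q a b; rewrite (distrC q) ab; lra.
move=> dF c1 c2; apply/eqP; rewrite -subr_eq0 -normr_le0 leNgt; apply/negP.
set M := 'D_v _ x; set L := 'D_u _ x => LM.
pose e := `|M - L| / 2; have e0 : 0 < e by rewrite divr_gt0.
have n1 : \forall y \near x, `|M - 'D_v ('D_u F) y| < e.
  by move/cvgrPdist_lt : c1; apply.
have n2 : \forall y \near x, `|L - 'D_u ('D_v F) y| < e.
  by move/cvgrPdist_lt : c2; apply.
move: dF n1 n2 => /nbhs_ballP[d1 /= d10 dF] /nbhs_ballP[d2 /= d20 n1].
move=> /nbhs_ballP[d3 /= d30 n2].
pose d := Num.min d1 (Num.min d2 d3).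
have d0 : 0 < d by rewrite !lt_min d10 d20.
have dP y : ball x d y -> [/\ ball x d1 y, ball x d2 y & ball x d3 y].
  by move=> xy; split; apply: le_ball xy; rewrite !ge_min lexx ?orbT.
(* Small enough for the parallelogram spanned by [h *: u] and [h *: v] at [x] to stay in the ball of
   radius [d]; the summand 1 avoids a zero denominator. *)
pose h := d / 2 / (`|u| + `|v| + 1).
have uv0 : 0 < `|u| + `|v| + 1 by rewrite ltr_wpDl// addr_ge0.
have h0 : 0 < h by rewrite !divr_gt0.
have inb (s t : R) a b : 0 <= s <= h -> 0 <= t <= h -> `|a| + `|b| = `|u| + `|v| ->
    ball x d (x + s *: a + t *: b).
  move=> /andP[s0 sh] /andP[t0 th] ab; rewrite -ball_normE/=.
  rewrite -normrN opprB -(addrA x) [x + _]addrC addrK.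
  apply: (le_lt_trans (ler_normD _ _)); rewrite !normrZ !ger0_norm//.
  apply: (@le_lt_trans _ _ (h * (`|u| + `|v| + 1))).
    have sa : s * `|a| <= h * `|a| by rewrite ler_wpM2r.
    have tb : t * `|b| <= h * `|b| by rewrite ler_wpM2r.
    rewrite -ab !mulrDr mulr1; lra.
  by rewrite /h divfK ?gt_eqF// ltr_pdivrMr// ltr_pMr// ltr1n.
have [|s [t [sh th st]]] := @second_difference _ _ F x u v h h0.
  by move=> s t sh th; have [/dF[]] := dP _ (inb _ _ _ _ sh th erefl).
have [|s' [t' [sh' th' st']]] := @second_difference _ _ F x v u h h0.
  by move=> s' t' sh' th'; have [/dF[]] := dP _ (inb _ _ _ _ sh' th' (addrC _ _)).
have PQ : 'D_v ('D_u F) (x + s *: u + t *: v) = 'D_u ('D_v F) (x + s' *: v + t' *: u).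
  have h2 : h ^+ 2 != 0 by rewrite expf_neq0// gt_eqF.
  apply: (mulIf h2); rewrite -st -st' (addrAC x _ (h *: u)) !opprB.
  by rewrite [LHS]addrACA [RHS]addrACA; congr (_ + _); exact: addrC.
have [_ _ /n2 b2] := dP _ (inb _ _ _ _ sh' th' (addrC _ _)).
have [_ /n1 + _] := dP _ (inb _ _ _ _ sh th erefl).
rewrite PQ => b1; have b3 : `|M - L| = e + e by rewrite /e -splitr.
move: b1 b2 b3; apply: far.
Qed.

(** * Locality of differentiability and smooth scalar functions *)

(** [G - F] vanishes near [x], hence is differentiable there with zero differential. *)
Lemma near_eq_differentiable (R : realType) (V W : normedModType R)
    (F G : V -> W) (x : V) :
  (\forall y \near x, F y = G y) -> differentiable F x -> differentiable G x.
Proof.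
move=> FG dF; pose K := G - F.
have K0 : K x = 0 by rewrite /K !fctE (nbhs_singleton FG) subrr.
have dK : K \o shift x = cst (K x) + (\0 : {linear V -> W}) +o_ 0 id.
  apply/eqaddoP => _/posnumP[e]; near=> y => /=.
  rewrite !fctE/= K0 addr0 subr0 /K !fctE.
  rewrite (_ : F (y + x) = G (y + x)) ?subrr ?normr0 ?mulr_ge0//.
  by near: y; move: FG; rewrite (near_shift 0) /= subr0.
have -> : G = F + K by rewrite /K addrC subrK.
apply: differentiableD => //; apply/diff_locallyP.
have c0 : continuous (\0 : {linear V -> W}) by move=> ?; exact: cst_continuous.
by rewrite (diff_unique c0 dK).
Unshelve. all: by end_near. Qed.

(** Identities between derivatives, such as that of an entry in [ndifferentiable_entry], are
    established on [A] only; this transfers higher differentiability across them. *)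
Lemma ndifferentiable_eq_on (R : realType) (V W : normedModType R) k (A : set V)
    (F G : V -> W) :
  open A -> (forall x, A x -> F x = G x) ->
  ndifferentiable k A F -> ndifferentiable k A G.
Proof.
move=> oA; elim: k F G => [//|k IH] F G FG [dF DF].
have nFG x : A x -> \forall y \near x, F y = G y.
  by move=> Ax; near=> y; apply: FG; near: y; exact: open_nbhs_nbhs.
split => [x Ax|v].
  exact: near_eq_differentiable (nFG _ Ax) (dF _ Ax).
apply: IH (DF v) => x Ax; exact/near_eq_derive/nFG.
Unshelve. all: by end_near. Qed.

Lemma ndifferentiable_entry (R : realType) (V : normedModType R) n k (A : set V)
    (F : V -> 'rV[R]_n) j :
  open A -> ndifferentiable k A F -> ndifferentiable k A (fun x => F x 0 j).
Proof.
move=> oA; elim: k F => [//|k IH] F [dF DF]; split => [x Ax|v].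
  exact: (differentiable_comp (dF _ Ax) (differentiable_coord _ _ _)).
apply: ndifferentiable_eq_on oA _ (IH _ (DF v)) => x Ax.
have := is_derive_mx_entry 0 j (@diff_derivable _ _ _ _ _ v (dF _ Ax)).
by move=> D; rewrite derive_val.
Qed.

Section SmoothFunction.
Variables (R : realType) (V : normedModType R) (A : set V) (F : V -> R).
Hypothesis F_smooth : smooth A F.

Lemma smooth_differentiable x : A x -> differentiable F x.
Proof. by case: (F_smooth 1) => dF _; exact: dF. Qed.

Lemma smooth_is_derive x v : A x -> is_derive x v F ('D_v F x).
Proof. by move=> Ax; exact/derivableP/diff_derivable/smooth_differentiable. Qed.

Lemma smooth_derive v : smooth A ('D_v F).
Proof. by move=> k; have [_] := F_smooth k.+1; apply. Qed.

End SmoothFunction.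

Lemma smooth_derive_comm (R : realType) (V : normedModType R) (A : set V)
    (F : V -> R) (x u v : V) :
  open A -> smooth A F -> A x -> 'D_v ('D_u F) x = 'D_u ('D_v F) x.
Proof.
move=> oA sF Ax; apply: derive_derive_comm.
- near=> y; have Ay : A y by near: y; exact: open_nbhs_nbhs.
  have D (G : V -> R) (w : V) : smooth A G -> derivable G y w.
    by move=> sG; have [] := smooth_is_derive sG w Ay.
  by split; apply: D => //; exact: smooth_derive.
- apply/differentiable_continuous/(smooth_differentiable _ Ax).
  exact/smooth_derive/smooth_derive.
- apply/differentiable_continuous/(smooth_differentiable _ Ax).
  exact/smooth_derive/smooth_derive.
Unshelve. all: by end_near. Qed.

(** * Rigidity of local isometries *)

(* [gf] and [gamma] on coordinate sequences, for vectors known only through the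
   derivatives of the components of a map. *)
Definition metric_form (R : realType) (F : R) (a b : nat -> R) : R :=
  - 2 * F * a 0%N * b 0%N + a 0%N * b 2%N + a 2%N * b 0%N + a 1%N * b 3%N
  + a 3%N * b 1%N.

Definition gamma_coord (R : realType) (a b : nat -> R) (j : nat) : R :=
  match j with
  | 2 => - (a 0%N * b 1%N + a 1%N * b 0%N)
  | 3 => a 0%N * b 0%N
  | _ => 0
  end.

Lemma is_derive_metric_form (R : realType) (V : normedModType R) (F : V -> R)
    (a b : nat -> V -> R) x w (F' : R) (a' b' : nat -> R) :
  is_derive x w F F' ->
  (forall j, is_derive x w (a j) (a' j)) -> (forall j, is_derive x w (b j) (b' j)) ->
  is_derive x w (fun y => metric_form (F y) (a^~ y) (b^~ y))
    (metric_form (F x) a' (b^~ x) + metric_form (F x) (a^~ x) b' - 2 * F' * a 0%N x * b 0%N x).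
Proof.
move=> dF da db.
have add (K G : V -> R) d d' : is_derive x w K d -> is_derive x w G d' ->
    is_derive x w (fun z => K z + G z : R) (d + d').
  by move=> dK dG; exact: (is_deriveD dK dG).
rewrite /metric_form; have D := add _ _ _ _ (add _ _ _ _ (add _ _ _ _ (add _ _ _ _
  (is_derive_mulf (is_derive_mulf (is_derive_mulcf (- 2) dF) (da 0%N)) (db 0%N))
  (is_derive_mulf (da 0%N) (db 2%N))) (is_derive_mulf (da 2%N) (db 0%N)))
  (is_derive_mulf (da 1%N) (db 3%N))) (is_derive_mulf (da 3%N) (db 1%N)).
by apply: is_derive_eq D _; ring.
Qed.

(** The [H] sequences stand for second derivatives of the components of an isometry, the [D]
    sequences for first ones, and [DG] for the derivative along [gamma w u]. Half of the first
    equation plus the second minus the third is Koszul's formula; the vector found orthogonal to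
    [Dv] compares the two Levi-Civita connections. *)
Lemma metric_form_koszul (R : realType) (F F' G' : R)
    (Hwu Huv Hvw Dw Du Dv DG w u v : nat -> R) :
  metric_form F Hwu Dv + metric_form F Du Hvw - 2 * F' * Dw 1%N * Du 0%N * Dv 0%N
    = - 2 * G' * w 1%N * u 0%N * v 0%N ->
  metric_form F Huv Dw + metric_form F Dv Hwu - 2 * F' * Du 1%N * Dv 0%N * Dw 0%N
    = - 2 * G' * u 1%N * v 0%N * w 0%N ->
  metric_form F Hvw Du + metric_form F Dw Huv - 2 * F' * Dv 1%N * Dw 0%N * Du 0%N
    = - 2 * G' * v 1%N * w 0%N * u 0%N ->
  metric_form F DG Dv = - (w 0%N * u 1%N + w 1%N * u 0%N) * v 0%N + w 0%N * u 0%N * v 1%N ->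
  metric_form F (fun j => Hwu j + F' * gamma_coord Dw Du j - G' * DG j) Dv = 0.
Proof.
move=> E1 E2 E3 /(congr1 ( *%R G')) E4.
have -> : metric_form F (fun j => Hwu j + F' * gamma_coord Dw Du j - G' * DG j) Dv =
    2^-1 * (metric_form F Hwu Dv + metric_form F Du Hvw - 2 * F' * Dw 1%N * Du 0%N * Dv 0%N
      + (metric_form F Huv Dw + metric_form F Dv Hwu - 2 * F' * Du 1%N * Dv 0%N * Dw 0%N)
      - (metric_form F Hvw Du + metric_form F Dw Huv - 2 * F' * Dv 1%N * Dw 0%N * Du 0%N))
    - G' * metric_form F DG Dv.
  by rewrite /metric_form /gamma_coord; field.
by rewrite E1 E2 E3 E4; field.
Qed.

Lemma gamma_coord_eq0 (R : realType) (F' G' : R) (H Dw Du DG : nat -> R) :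
  let a j := H j + F' * gamma_coord Dw Du j - G' * DG j in
  a 0%N = 0 -> a 1%N = 0 -> a 3%N = 0 ->
  [/\ H 0%N = G' * DG 0%N, H 1%N = G' * DG 1%N &
      H 3%N = G' * DG 3%N - F' * (Dw 0%N * Du 0%N)].
Proof. by rewrite /= => a0 a1 a3; split; lra. Qed.

Lemma derive_frame (R : realType) (F : 'rV[R]_4 -> R) x u :
  differentiable F x ->
  'D_u F x = u 0 (inord 0) * 'D_(frame 0) F x + u 0 (inord 1) * 'D_(frame 1) F x
    + u 0 (inord 2) * 'D_(frame 2) F x + u 0 (inord 3) * 'D_(frame 3) F x.
Proof.
move=> dF; rewrite !deriveE//.
have {1}-> : u = row4 (u 0 (inord 0)) (u 0 (inord 1)) (u 0 (inord 2)) (u 0 (inord 3)).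
  by apply: rV4P; rewrite row4E.
by rewrite /row4 !linearD !linearZ.
Qed.

Lemma mulmx_row_entry (R : realType) n (g : 'rV[R]_n -> 'M[R]_n) x m (M : 'M[R]_(m, n))
    (a : 'rV[R]_n) k : inner g x a (row k M) = (a *m g x *m M^T) 0 k.
Proof.
rewrite /inner mxE [RHS]mxE; apply: eq_bigr => i _.
by congr (_ * _); rewrite !mxE.
Qed.

(* Here [D j u] is the derivative of the [j]-th component of an isometry in the
   direction [u], and [T w u v] the third derivative of the last component. *)
Lemma weight_algebra (R : realType) (D : nat -> 'rV[R]_4 -> R) (g h p q : R) :
  (forall u v, metric_form g (D^~ u) (D^~ v) =
     metric_form h (fun j => u 0 (inord j)) (fun j => v 0 (inord j))) ->
  D 0%N (frame 2) = 0 -> D 0%N (frame 3) = 0 -> D 1%N (frame 2) = 0 -> D 1%N (frame 3) = 0 ->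
  let T (w u v : 'rV[R]_4) := p * w 0 (inord 1) *
    (- (u 0 (inord 0) * v 0 (inord 1) + u 0 (inord 1) * v 0 (inord 0)) * D 3 (frame 2)
     + u 0 (inord 0) * v 0 (inord 0) * D 3 (frame 3))
    - q * D 1%N w * (D 0%N u * D 0%N v) in
  (forall w u v, T w u v = T u w v) ->
  let t := D 0%N (frame 0) * D 1%N (frame 1) - D 0%N (frame 1) * D 1%N (frame 0) in
  p = q * t ^+ 2 /\ t != 0.
Proof.
move=> iso x2 x3 y2 y3 /= comm; have := comm (frame 1) (frame 0) (frame 0).
have := comm (frame 1) (frame 0) (frame 1); have := iso (frame 3) (frame 1).
have := iso (frame 3) (frame 0); have := iso (frame 2) (frame 1).
have := iso (frame 2) (frame 0).
rewrite /metric_form x2 x3 y2 y3 !frameE//= {iso comm x2 x3 y2 y3}.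
move: (D 0%N (frame 0)) (D 0%N (frame 1)) (D 1%N (frame 0)) (D 1%N (frame 1)) (D 2%N (frame 2))
  (D 2%N (frame 3)) (D 3 (frame 2)) (D 3 (frame 3)) => a0 a1 b0 b1 Z2 Z3 W2 W3.
move=> E20 E21 E30 E31 EA EB; set t := a0 * b1 - a1 * b0.
(* These four equations say that the block [Z2, W2; Z3, W3] is inverse to [a0, a1; b0, b1], whose
   determinant is [t]. Cramer's rule then gives [tW3] and [tW2]. *)
have F20 : Z2 * a0 + W2 * b0 = 1 by lra.
have F21 : Z2 * a1 + W2 * b1 = 0 by lra.
have F30 : Z3 * a0 + W3 * b0 = 0 by lra.
have F31 : Z3 * a1 + W3 * b1 = 1 by lra.
have GA : p * W2 = - q * a1 * t by rewrite /t; lra.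
have GB : p * W3 = q * a0 * t by rewrite /t; lra.
have tW3 : W3 * t = a0.
  rewrite (_ : W3 * t = a0 * (Z3 * a1 + W3 * b1) - a1 * (Z3 * a0 + W3 * b0)).
    by rewrite F31 F30; ring.
  by rewrite /t; ring.
have tW2 : W2 * t = - a1.
  rewrite (_ : W2 * t = a0 * (Z2 * a1 + W2 * b1) - a1 * (Z2 * a0 + W2 * b0)).
    by rewrite F21 F20; ring.
  by rewrite /t; ring.
have td : t * (Z2 * W3 - W2 * Z3) = 1.
  rewrite (_ : t * _ = (Z2 * a0 + W2 * b0) * (Z3 * a1 + W3 * b1) -
    (Z2 * a1 + W2 * b1) * (Z3 * a0 + W3 * b0)); last by rewrite /t; ring.
  by rewrite F20 F21 F30 F31; ring.
have t0 : t != 0 by apply/eqP => t0; move/eqP: td; rewrite t0 mul0r eq_sym oner_eq0.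
split => //; apply/eqP; rewrite -subr_eq0.
(* The difference [p - q * t ^+ 2] is killed by [a0] and by [a1], hence by [t = a0 * b1 - a1 * b0],
   which is nonzero. *)
have k0 : a0 * (p - q * t ^+ 2) = 0.
  rewrite -{1}tW3 (_ : _ * _ = t * (p * W3) - q * (W3 * t) * t ^+ 2); last by ring.
  by rewrite GB tW3; ring.
have k1 : a1 * (p - q * t ^+ 2) = 0.
  rewrite (_ : a1 = - (W2 * t)); last by rewrite tW2 opprK.
  rewrite (_ : _ * _ = - (t * (p * W2)) + q * (W2 * t) * t ^+ 2); last by ring.
  by rewrite GA tW2; ring.
apply/eqP/(mulfI t0); rewrite mulr0.
rewrite (_ : t * _ = (a0 * (p - q * t ^+ 2)) * b1 - (a1 * (p - q * t ^+ 2)) * b0).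
  by rewrite k0 k1 !mul0r subr0.
by rewrite {1}/t; ring.
Qed.

Lemma frame_ord (R : realType) (i : 'I_4) : frame i = delta_mx 0 i :> 'rV[R]_4.
Proof. by rewrite /frame inord_val. Qed.

Section Rigidity.

(* Otherwise failing to unify two derivatives unfolds them down to limits. *)
Opaque derive frame gamma.
Variables (R : realType) (O : set R) (A : set 'rV[R]_4) (c : nat -> 'rV[R]_4 -> R).
(* [c j] are the components of a local isometry; [f1], .., [f4] stand for the
   derivatives of [f]. *)
Variables (f f1 f2 f3 f4 : R -> R).
Hypotheses (A_open : open A) (AO : forall x, A x -> O (coord_y x)).
Hypotheses (c_smooth : forall j, smooth A (c j)) (cO : forall x, A x -> O (c 1 x)).
Hypotheses (df : forall y, O y -> is_derive y 1 f (f1 y))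
  (df1 : forall y, O y -> is_derive y 1 f1 (f2 y))
  (df2 : forall y, O y -> is_derive y 1 f2 (f3 y))
  (df3 : forall y, O y -> is_derive y 1 f3 (f4 y)).
Hypotheses (f2_gt0 : forall y, O y -> 0 < f2 y) (f3_gt0 : forall y, O y -> 0 < f3 y).
Hypothesis c_isometry : forall x, A x -> forall u v,
  metric_form (f (c 1 x)) (fun j => 'D_u (c j) x) (fun j => 'D_v (c j) x) =
  metric_form (f (coord_y x)) (fun j => u 0 (inord j)) (fun j => v 0 (inord j)).

Let nearA x : A x -> \forall y \near x, A y.
Proof. by move=> Ax; apply: open_nbhs_nbhs; split. Qed.

Let dc j x u : A x -> is_derive x u (c j) ('D_u (c j) x).
Proof. by move=> Ax; exact: (smooth_is_derive (c_smooth j) u Ax). Qed.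

Let ddc j x u v : A x -> is_derive x u ('D_v (c j)) ('D_u ('D_v (c j)) x).
Proof. by move=> Ax; exact: (smooth_is_derive (smooth_derive (c_smooth j) v) u Ax). Qed.

Let dcoord (g : R -> R) (g' : R) x w : A x -> is_derive (coord_y x) 1 g g' ->
  is_derive x w (fun y => g (coord_y y)) (g' * w 0 (inord 1)).
Proof. by move=> Ax dg; apply: is_derive_chain; exact: is_derive_entry. Qed.

(** The Jacobian matrix [M] satisfies [M g M^T = g'] with both Gram matrices invertible, so it is
    invertible and the vectors ['D_v c] span. *)
Lemma metric_form_nondegenerate x (a : nat -> R) : A x ->
  (forall v, metric_form (f (c 1 x)) a (fun j => 'D_v (c j) x) = 0) ->
  [/\ a 0%N = 0, a 1%N = 0, a 2%N = 0 & a 3%N = 0].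
Proof.
move=> Ax aD.
(* Since [gf] depends on y alone, [Q] can stand for the image point. *)
pose Q : 'rV[R]_4 := row4 0 (c 1 x) 0 0.
have Qy : coord_y Q = c 1 x by rewrite /coord_y row4E.
pose M : 'M[R]_4 := \matrix_(i, j) 'D_(frame i) (c j) x.
pose arow : 'rV[R]_4 := \row_j a j.
have Mrow i j : (j < 4)%N -> row i M 0 (inord j) = 'D_(frame i) (c j) x.
  by move=> j4; rewrite !mxE inordK.
have innerM i k : inner (gf f) Q (row i M) (row k M) = inner (gf f) x (frame i) (frame k).
  by rewrite !inner_gf !Mrow// Qy; exact: c_isometry.
have MGM : M *m gf f Q *m M^T = gf f x.
  apply/matrixP => i k.
  have := innerM i k; rewrite mulmx_row_entry -!row_mul mxE => ->.
  by rewrite !frame_ord inner_delta -rowE mxE.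
have /andP[_ MTu] : (M *m gf f Q \in unitmx) && (M^T \in unitmx).
  by rewrite -unitmx_mul MGM gf_unit.
have a0 : arow = 0.
  rewrite -[arow](mulmxK (gf_unit f Q)) -[arow *m gf f Q](mulmxK MTu).
  rewrite (_ : arow *m gf f Q *m M^T = 0) ?mul0mx//.
  apply/rowP => k; rewrite -mulmx_row_entry mxE inner_gf !Mrow// Qy.
  by rewrite -[RHS](aD (frame k)) /metric_form !mxE !inordK.
have E j : (j < 4)%N -> a j = 0.
  by move=> j4; have := congr1 (fun r : 'rV[R]_4 => r 0 (inord j)) a0; rewrite !mxE inordK.
by split; exact: E.
Qed.

(** The isometry equation differentiated along [w]. Keeping [H] and [K] as variables lets [hessian]
    choose the order of the second derivatives. *)
Lemma derive_isometry x w u v (H K : nat -> R) : A x ->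
  (forall j, H j = 'D_w ('D_u (c j)) x) -> (forall j, K j = 'D_w ('D_v (c j)) x) ->
  metric_form (f (c 1 x)) H (fun j => 'D_v (c j) x)
  + metric_form (f (c 1 x)) (fun j => 'D_u (c j) x) K
  - 2 * (f1 (c 1 x)) * 'D_w (c 1) x * 'D_u (c 0) x * 'D_v (c 0) x =
  - 2 * f1 (coord_y x) * w 0 (inord 1) * u 0 (inord 0) * v 0 (inord 0).
Proof.
move=> Ax /funext -> /funext ->.
have dfc : is_derive x w (fun y => f (c 1 y)) (f1 (c 1 x) * 'D_w (c 1) x).
  by apply: is_derive_chain; [apply: df; exact: cO | exact: dc].
have D1 := is_derive_metric_form dfc (fun j => ddc j w u Ax) (fun j => ddc j w v Ax).
have dfy := dcoord w Ax (df (AO Ax)).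
have D2 := is_derive_metric_form dfy
  (fun j => is_derive_cst (u 0 (inord j)) x w) (fun j => is_derive_cst (v 0 (inord j)) x w).
move: (@derive_val _ _ _ _ _ _ _ D1) (@derive_val _ _ _ _ _ _ _ D2).
rewrite (@near_eq_derive _ _ _ _ (fun y => metric_form (f (coord_y y))
  (fun j => u 0 (inord j)) (fun j => v 0 (inord j)))); last first.
  by near=> y; apply: c_isometry; near: y; exact: nearA.
move=> ->; rewrite /metric_form/= !mulrA => ->; ring.
Unshelve. all: by end_near. Qed.

(** The vector of [metric_form_koszul] is orthogonal to every ['D_v c], hence zero. The components 0
    and 1 of [gamma_coord] vanish, and its component 3 is the last term in the third equation. *)
Lemma hessian x w u : A x ->
  [/\ 'D_w ('D_u (c 0)) x = f1 (coord_y x) * 'D_(gamma w u) (c 0) x,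
      'D_w ('D_u (c 1)) x = f1 (coord_y x) * 'D_(gamma w u) (c 1) x &
      'D_w ('D_u (c 3)) x = f1 (coord_y x) * 'D_(gamma w u) (c 3) x
        - f1 (c 1 x) * ('D_w (c 0) x * 'D_u (c 0) x)].
Proof.
move=> Ax.
have sym p q j : 'D_p ('D_q (c j)) x = 'D_q ('D_p (c j)) x.
  exact: (smooth_derive_comm q p A_open (c_smooth j) Ax).
pose a j := 'D_w ('D_u (c j)) x +
  f1 (c 1 x) * gamma_coord (fun j => 'D_w (c j) x) (fun j => 'D_u (c j) x) j -
  f1 (coord_y x) * 'D_(gamma w u) (c j) x.
have [|a0 a1 _ a3] := @metric_form_nondegenerate x a Ax; last first.
  exact: (@gamma_coord_eq0 _ _ _ (fun j => 'D_w ('D_u (c j)) x) (fun j => 'D_w (c j) x)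
    (fun j => 'D_u (c j) x) (fun j => 'D_(gamma w u) (c j) x) a0 a1 a3).
move=> v; apply: (@metric_form_koszul _ _ _ _ (fun j => 'D_w ('D_u (c j)) x)
    (fun j => 'D_u ('D_v (c j)) x) (fun j => 'D_v ('D_w (c j)) x)
    (fun j => 'D_w (c j) x) (fun j => 'D_u (c j) x) (fun j => 'D_v (c j) x)
    (fun j => 'D_(gamma w u) (c j) x)
    (fun j => w 0 (inord j)) (fun j => u 0 (inord j)) (fun j => v 0 (inord j))).
- by apply: (@derive_isometry x w u v) => // j; exact: sym.
- by apply: (@derive_isometry x u v w) => // j; exact: sym.
- by apply: (@derive_isometry x v w u) => // j; exact: sym.
- rewrite c_isometry// /metric_form; have [-> -> -> ->] := gammaE w u; ring.
Qed.

Lemma derive_gamma F x w u : A x -> smooth A F ->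
  'D_(gamma w u) F x =
    - (w 0 (inord 0) * u 0 (inord 1) + w 0 (inord 1) * u 0 (inord 0)) * 'D_(frame 2) F x
    + w 0 (inord 0) * u 0 (inord 0) * 'D_(frame 3) F x.
Proof.
move=> Ax sF; rewrite derive_frame; last exact: smooth_differentiable.
by have [-> -> -> ->] := gammaE w u; rewrite !mul0r !add0r.
Qed.

Lemma derive_gamma_gamma (F : 'rV[R]_4 -> R) x w u v : 'D_(gamma w (gamma u v)) F x = 0.
Proof. by have [G0 G1 _ _] := gammaE u v; rewrite gamma_eq0// derive0. Qed.

(** Since [gamma w (gamma u v) = 0], differentiating the hypothesis gives [f'' dy(w)] times the
    derivative of [F] along [gamma u v]. Exchanging d_y and d_x in the first two directions leaves
    [f''] times each of the two derivatives equal to 0. *)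
Lemma transverse_derive_eq0 (F : 'rV[R]_4 -> R) x : smooth A F ->
  (forall x w u, A x -> 'D_w ('D_u F) x = f1 (coord_y x) * 'D_(gamma w u) F x) ->
  A x -> 'D_(frame 2) F x = 0 /\ 'D_(frame 3) F x = 0.
Proof.
move=> sF hF Ax.
set d2 : R := 'D_(frame 2) F x; set d3 : R := 'D_(frame 3) F x.
pose rhs (w u v : 'rV[R]_4) := f2 (coord_y x) * w 0 (inord 1) *
  (- (u 0 (inord 0) * v 0 (inord 1) + u 0 (inord 1) * v 0 (inord 0)) * d2
   + u 0 (inord 0) * v 0 (inord 0) * d3).
have third w u v : 'D_w ('D_u ('D_v F)) x = rhs w u v.
  rewrite /rhs /d2 /d3 -(derive_gamma u v Ax sF).
  rewrite (@near_eq_derive _ _ _ _ (fun y => f1 (coord_y y) * 'D_(gamma u v) F y)).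
    have D := is_derive_mulf (dcoord w Ax (df1 (AO Ax)))
      (smooth_is_derive (smooth_derive sF (gamma u v)) w Ax).
    by rewrite derive_val (hF _ _ _ Ax) derive_gamma_gamma !mulr0 addr0.
  by near=> y; apply: hF; near: y; exact: nearA.
have f2x : f2 (coord_y x) != 0 by exact: (lt0r_neq0 (f2_gt0 (AO Ax))).
have comm w u v : rhs w u v = rhs u w v.
  apply: etrans (esym (third w u v)) (etrans _ (third u w v)).
  exact: (smooth_derive_comm u w A_open (smooth_derive sF v) Ax).
have := comm (frame 1) (frame 0) (frame 0); have := comm (frame 1) (frame 0) (frame 1).
move: d2 d3 @rhs {third comm} f2x => d2 d3; move: (f2 _) => p /= p0.
rewrite !frameE//= => E2 E3.
by split; apply: (mulfI p0); [move: E2|move: E3]; lra.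
Unshelve. all: by end_near. Qed.

Lemma transverse01 j x : (j < 2)%N -> A x ->
  'D_(frame 2) (c j) x = 0 /\ 'D_(frame 3) (c j) x = 0.
Proof.
case: j => [|[|//]] _ Ax; apply: transverse_derive_eq0 => // y w u Ay;
by have [] := hessian w u Ay.
Qed.

Lemma hessian_eq0 j x w u : (j < 2)%N -> A x -> 'D_w ('D_u (c j)) x = 0.
Proof.
move=> j2 Ax; have [b2 b3] := transverse01 j2 Ax.
have : 'D_(gamma w u) (c j) x = 0 by rewrite derive_gamma// b2 b3 !mulr0 addr0.
by case: j j2 {b2 b3} => [|[|//]] _; have [H0 H1 _] := hessian w u Ax;
  rewrite ?H0 ?H1 => ->; rewrite mulr0.
Qed.

(** Differentiates the third formula of [hessian]: the second derivatives of [c 0] vanish, and so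
    does that of [c 3] along [w] and [gamma u v], because [c 0] is constant along [gamma u v]. *)
Lemma third_derive3 x w u v : A x ->
  'D_w ('D_u ('D_v (c 3))) x =
    f2 (coord_y x) * w 0 (inord 1) * 'D_(gamma u v) (c 3) x
    - f2 (c 1 x) * 'D_w (c 1) x * ('D_u (c 0) x * 'D_v (c 0) x).
Proof.
move=> Ax.
rewrite (@near_eq_derive _ _ _ _ (fun y => f1 (coord_y y) * 'D_(gamma u v) (c 3) y -
  f1 (c 1 y) * ('D_u (c 0) y * 'D_v (c 0) y))); last first.
  by near=> y; have [] := @hessian y u v; [near: y; exact: nearA|].
have df1c : is_derive x w (fun y => f1 (c 1 y)) (f2 (c 1 x) * 'D_w (c 1) x).
  by apply: is_derive_chain; [apply: df1; exact: cO | exact: dc].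
have D := is_derive_subf
  (is_derive_mulf (dcoord w Ax (df1 (AO Ax))) (ddc 3 w (gamma u v) Ax))
  (is_derive_mulf df1c (is_derive_mulf (ddc 0 w u Ax) (ddc 0 w v Ax))).
rewrite derive_val !(@hessian_eq0 0)//.
have [_ _ ->] := hessian w (gamma u v) Ax; rewrite derive_gamma_gamma.
have [b2 b3] := @transverse01 0 x isT Ax.
rewrite (derive_gamma u v Ax (c_smooth 0)) b2 b3; ring.
Unshelve. all: by end_near. Qed.

Let X0 (x : 'rV[R]_4) : R := 'D_(frame 0) (c 0) x.
Let X1 (x : 'rV[R]_4) : R := 'D_(frame 1) (c 0) x.
Let Y0 (x : 'rV[R]_4) : R := 'D_(frame 0) (c 1) x.
Let Y1 (x : 'rV[R]_4) : R := 'D_(frame 1) (c 1) x.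
(** The factor by which pullback multiplies [dx /\ dy]. *)
Let t (x : 'rV[R]_4) : R := X0 x * Y1 x - X1 x * Y0 x.

Lemma weight2 x : A x -> f2 (coord_y x) = f2 (c 1 x) * t x ^+ 2 /\ t x != 0.
Proof.
move=> Ax.
have [x2 x3] := @transverse01 0 x isT Ax; have [y2 y3] := @transverse01 1 x isT Ax.
apply: (@weight_algebra _ (fun j w => 'D_w (c j) x) (f (c 1 x)) (f (coord_y x))
  (f2 (coord_y x)) (f2 (c 1 x)) _ x2 x3 y2 y3); first exact: c_isometry.
move=> w u v /=.
rewrite -(derive_gamma u v Ax (c_smooth 3)) -(derive_gamma w v Ax (c_smooth 3)).
apply: etrans (esym (third_derive3 w u v Ax)) (etrans _ (third_derive3 u w v Ax)).
exact: (smooth_derive_comm u w A_open (smooth_derive (c_smooth 3) v) Ax).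
Qed.

Lemma derive_t x w : A x -> is_derive x w t 0.
Proof.
move=> Ax.
have D := is_derive_subf
  (is_derive_mulf (ddc 0 w (frame 0) Ax) (ddc 1 w (frame 1) Ax))
  (is_derive_mulf (ddc 0 w (frame 1) Ax) (ddc 1 w (frame 0) Ax)).
apply: is_derive_eq D _.
have H0 u : 'D_w ('D_u (c 0)) x = 0 by exact: (@hessian_eq0 0).
have H1 u : 'D_w ('D_u (c 1)) x = 0 by exact: (@hessian_eq0 1).
by rewrite !H0 !H1 !mul0r !mulr0 !addr0 subr0.
Qed.

(** Passes from the relation for one derivative of [f] to the next; used for [f''] and then for
    [f''']. *)
Lemma derive_weight (g g' : R -> R) (s : 'rV[R]_4 -> R) :
  (forall y, O y -> is_derive y (1 : R) g (g' y)) ->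
  (forall x, A x -> g (coord_y x) = g (c 1 x) * s x) ->
  (forall x w, A x -> is_derive x w s 0) ->
  forall x (w : 'rV[R]_4), A x ->
    g' (coord_y x) * w 0 (inord 1) = g' (c 1 x) * 'D_w (c 1) x * s x.
Proof.
move=> dg gE ds x w Ax.
have D1 := dcoord w Ax (dg _ (AO Ax)).
have dgc : is_derive x w (fun y => g (c 1 y)) (g' (c 1 x) * 'D_w (c 1) x).
  by apply: is_derive_chain; [apply: dg; exact: cO | exact: dc].
have D2 := is_derive_mulf dgc (ds x w Ax).
have near_gE : \forall y \near x, g (coord_y y) = g (c 1 y) * s y.
  by near=> y; apply: gE; near: y; exact: nearA.
have := near_eq_derive w near_gE.
rewrite (@derive_val _ _ _ _ _ _ _ D1) (@derive_val _ _ _ _ _ _ _ D2) => ->.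
by rewrite mulr0 addr0.
Unshelve. all: by end_near. Qed.

(** Differentiates [weight2]. Along d_x the left side is 0, so [Y0] vanishes because [f'''] and [t]
    do not; along d_y the relation for [f'''] appears. *)
Lemma weight3 x : A x ->
  Y0 x = 0 /\ f3 (coord_y x) = f3 (c 1 x) * (Y1 x * t x ^+ 2).
Proof.
move=> Ax.
have dt2 (y w : 'rV[R]_4) : A y -> is_derive y w (fun z => t z * t z) 0.
  move=> Ay; apply: is_derive_eq (is_derive_mulf (derive_t w Ay) (derive_t w Ay)) _.
  by rewrite mul0r mulr0 addr0.
have W w := derive_weight df2 (fun y Ay => (weight2 Ay).1) dt2 w Ax.
have := W (frame 0); have := W (frame 1); rewrite !frameE//= mulr1 mulr0 -/(Y0 x) -/(Y1 x).
have t0 := (weight2 Ax).2; have f3c := lt0r_neq0 (f3_gt0 (cO Ax)).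
move: (f3 (coord_y x)) (f3 (c 1 x)) (Y0 x) (Y1 x) (t x) t0 f3c.
move=> a b y0 y1 z z0 b0 -> /esym/eqP; rewrite !mulf_eq0.
by rewrite (negbTE b0) (negbTE z0)/= orbF => /eqP ->; rewrite mulrA.
Qed.

Lemma weight4 x : A x -> f4 (coord_y x) = f4 (c 1 x) * (Y1 x ^+ 2 * t x ^+ 2).
Proof.
move=> Ax.
have ds (y w : 'rV[R]_4) : A y -> is_derive y w (fun z => Y1 z * (t z * t z)) 0.
  move=> Ay; apply: is_derive_eq (is_derive_mulf (ddc 1 w (frame 1) Ay)
    (is_derive_mulf (derive_t w Ay) (derive_t w Ay))) _.
  by rewrite hessian_eq0// !mul0r !mulr0 addr0 mulr0 addr0.
have := derive_weight df3 (fun y Ay => (weight3 Ay).2) ds (frame 1) Ax.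
rewrite frameE//= mulr1 -/(Y1 x) => ->; ring.
Qed.

Lemma isometry_rigidity x : A x -> exists t s : R,
  [/\ forall u v, 'D_u (c 0) x * 'D_v (c 1) x - 'D_u (c 1) x * 'D_v (c 0) x =
        t * dxdy u v,
      forall u, 'D_u (c 1) x = s * u 0 (inord 1) &
      [/\ f2 (coord_y x) = f2 (c 1 x) * t ^+ 2 * s ^+ 0,
          f3 (coord_y x) = f3 (c 1 x) * t ^+ 2 * s ^+ 1 &
          f4 (coord_y x) = f4 (c 1 x) * t ^+ 2 * s ^+ 2]].
Proof.
move=> Ax; exists (t x), (Y1 x).
have [x2 x3] := @transverse01 0 x isT Ax; have [y2 y3] := @transverse01 1 x isT Ax.
have [Y00 W3] := weight3 Ax; have [W2 _] := weight2 Ax; have W4 := weight4 Ax.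
have D0 (u : 'rV[R]_4) : 'D_u (c 0) x = u 0 (inord 0) * X0 x + u 0 (inord 1) * X1 x.
  rewrite (derive_frame u (smooth_differentiable (c_smooth 0) Ax)) x2 x3.
  by rewrite !mulr0 !addr0.
have D1 (u : 'rV[R]_4) : 'D_u (c 1) x = Y1 x * u 0 (inord 1).
  rewrite (derive_frame u (smooth_differentiable (c_smooth 1) Ax)) y2 y3 -/(Y0 x) Y00.
  by rewrite !mulr0 !addr0 add0r mulrC.
split => //; last by split; rewrite ?W2 ?W3 ?W4; ring.
move=> u v; rewrite !D0 !D1 /t Y00 /dxdy.
by move: (X0 x) (X1 x) (Y1 x) => a b d; ring.
Qed.
End Rigidity.

(** * From local homogeneity to curvature homogeneity *)

Section InnerBilinear.
Variables (R : realType) (n : nat) (g : 'rV[R]_n -> 'M[R]_n) (p : 'rV[R]_n).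

(** Lets [inner g p] serve as the [{biscalar V}] of a curvature model. *)
Lemma inner_bilinear : bilinear_for *%R *%R (inner g p).
Proof.
split=> w k u v; rewrite /inner.
  by rewrite !mulmxDl -!scalemxAl !mxE.
by rewrite linearP/= mulmxDr -scalemxAr !mxE.
Qed.

HB.instance Definition _ :=
  bilinear_isBilinear.Build R 'rV[R]_n 'rV[R]_n R *%R *%R (inner g p) inner_bilinear.

End InnerBilinear.

Lemma isometry_bijective (R : realType) (f : R -> R) (x y : 'rV[R]_4)
    (L : {linear 'rV[R]_4 -> 'rV[R]_4}) :
  (forall u v, inner (gf f) y (L u) (L v) = inner (gf f) x u v) -> bijective L.
Proof.
move=> Liso; pose M := lin1_mx L.
have LM u : L u = u *m M by rewrite mul_rV_lin1.
have MGM : M *m gf f y *m M^T = gf f x.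
  apply/matrixP => i k; have := Liso (delta_mx 0 i) (delta_mx 0 k).
  rewrite !LM -!rowE mulmx_row_entry -!row_mul mxE => ->.
  by rewrite inner_delta -rowE mxE.
have Mu : M \in unitmx.
  have : M *m gf f y *m M^T \in unitmx by rewrite MGM gf_unit.
  by rewrite !unitmx_mul => /andP[/andP[]].
exists (mulmx^~ (invmx M)) => u; rewrite LM; [exact: mulmxK|exact: mulmxKV].
Qed.

(** Restates [isometry_rigidity] for the differential of [phi], by passing to its components. *)
Lemma isometry_pullback (R : realType) (O : set R) (f : R -> R)
    (A B : set 'rV[R]_4) (phi : 'rV[R]_4 -> 'rV[R]_4) (x : 'rV[R]_4) :
  real_analytic O f ->
  (forall y, O y -> 0 < f^`(2)%classic y) ->
  (forall y, O y -> 0 < f^`(3)%classic y) ->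
  open A -> A `<=` Mf_domain O -> B `<=` Mf_domain O ->
  isometry_onto (gf f) A B phi -> A x ->
  exists t s : R,
  [/\ forall u v, dxdy ('d phi x u) ('d phi x v) = t * dxdy u v,
      forall u, 'd phi x u 0 (inord 1) = s * u 0 (inord 1) &
      forall i : 'I_3, f^`(i.+2)%classic (coord_y x) =
        f^`(i.+2)%classic (coord_y (phi x)) * t ^+ 2 * s ^+ i].
Proof.
move=> fO f2 f3 oA AM BM [phiA sphi _ iso] Ax.
(* For [j >= 4], [inord j] is the index 0, so [c j] is smooth for every [j]. *)
pose c (j : nat) (z : 'rV[R]_4) := phi z 0 (inord j).
have c_smooth j : smooth A (c j) by move=> k; exact: ndifferentiable_entry.
have dphi z u j : A z -> 'd phi z u 0 (inord j) = 'D_u (c j) z.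
  move=> Az; have dz : differentiable phi z by case: (sphi 1%N) => + _; exact.
  have D := is_derive_mx_entry 0 (inord j) (@diff_derivable _ _ _ _ _ u dz).
  by rewrite (@derive_val _ _ _ _ _ _ _ D) deriveE.
have cO z : A z -> O (c 1%N z).
  by move=> Az; apply: (BM (phi z)); rewrite -phiA; exists z.
have c_iso z : A z -> forall u v : 'rV[R]_4,
    metric_form (f (c 1%N z)) (fun j => 'D_u (c j) z) (fun j => 'D_v (c j) z) =
    metric_form (f (coord_y z)) (fun j => u 0 (inord j)) (fun j => v 0 (inord j)).
  move=> Az u v; have := iso z Az u v; rewrite !inner_gf /metric_form.
  by rewrite !dphi.
have d n y (Oy : O y) := derivable_derive1n n fO Oy.
have [t [s [dxdyE yE [E2 E3 E4]]]] := @isometry_rigidity R O A c _ _ _ _ _ oA AM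
  c_smooth cO (d 0%N) (d 1%N) (d 2%N) (d 3%N) f2 f3 c_iso x Ax.
exists t, s; split.
- by move=> u v; rewrite /dxdy !dphi.
- by move=> u; rewrite dphi.
- by case=> [[|[|[|//]]] ?].
Qed.

(** The model is the tangent space at a point [Q] over [y0]; the isomorphism at [P] is the
    differential of a local isometry from [P] to [Q]. *)
Lemma homogeneous_curvature_homogeneous (R : realType) (O : set R) (f : R -> R) :
  open O -> real_analytic O f ->
  (forall y, O y -> 0 < f^`(2)%classic y) ->
  (forall y, O y -> 0 < f^`(3)%classic y) ->
  locally_homogeneous (Mf_domain O) (gf f) ->
  curvature_homogeneous 2 (Mf_domain O) (gf f).
Proof.
move=> oO fO f2 f3 hom.
(* Stated as an implication so that an empty [O] also supplies a model. *)
have [y0 y0P] : exists y0 : R, forall y, O y -> O y0.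
  have [[y0 Oy0]|O0] := pselect (exists y, O y); first by exists y0.
  by exists 0 => y Oy; case: O0; exists y.
pose Q : 'rV[R]_4 := y0 *: frame 1.
have Qy : coord_y Q = y0 by rewrite /coord_y mxE frameE// mulr1.
exists 'rV[R]_4, (inner (gf f) Q),
  (fun i : 'I_3 => @curvature_form R i (f^`(i.+2)%classic y0)); split.
- move=> u v; rewrite -[LHS]/(inner (gf f) Q u v) -[RHS]/(inner (gf f) Q v u).
  by rewrite !inner_gf; ring.
- move=> u u0; rewrite -[u](mulmxK (gf_unit f Q)) (_ : u *m gf f Q = 0) ?mul0mx//.
  by apply/rowP => j; rewrite -inner_delta mxE; exact: u0.
- by move=> i; exact: curvature_form_multilinear.
move=> P OP.
have OQ : Mf_domain O Q by rewrite /Mf_domain/= Qy; exact: y0P OP.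
have [A [B [phi [[[oA AP] AM] [_ BM] iso phiP]]]] := hom P Q OP OQ.
have [t [s [dxdyE yE fE]]] := isometry_pullback fO f2 f3 oA AM BM iso AP.
exists ('d phi P).
have inE u v : inner (gf f) Q ('d phi P u) ('d phi P v) = inner (gf f) P u v.
  by have [_ _ _ /(_ P AP)] := iso; rewrite phiP.
split => //; first exact: isometry_bijective inE.
move=> i v; rewrite (curvature_form_pullback _ _ dxdyE yE).
by rewrite (nabla_curvature_gf oO fO _ OP) fE phiP Qy.
Qed.

Theorem theorem1p8 (R : realType) (O : set R) (f : R -> R)
  (O_open : open O) (O_connected : connected O)
  (f_analytic : real_analytic O f)
  (f2_gt0 : forall y, O y -> 0 < f^`(2)%classic y)
  (f3_gt0 : forall y, O y -> 0 < f^`(3)%classic y) :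
  [<-> locally_homogeneous (Mf_domain O) (gf f);
       curvature_homogeneous 2 (Mf_domain O) (gf f);
       exists k : R, forall y, O y -> alpha2 f y = k;
       power_form O f^`(2)%classic \/ exponential_form O f^`(2)%classic].
Proof.
tfae.
- exact: homogeneous_curvature_homogeneous.
- exact: alpha2_constant.
- move=> [k kE]; exact: (power_or_exponential O_connected
    (fun y Oy => derivable_derive1n 2 f_analytic Oy)
    (fun y Oy => derivable_derive1n 3 f_analytic Oy) f2_gt0 f3_gt0 kE).
- by case; [exact: power_homogeneous | exact: exponential_homogeneous].
Qed.
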